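(* Let $T$ be a tree with $t\geq 2$ vertices, radius $h$ and maximum degree $d$, and let $G$ be a graph that does not contain $T^+$ as a minor. Then there exists a graph $H$ with $\mathrm{tw}(H)\leq 4h-1$ such that $G$ is contained in $H\boxtimes K_{(2t-1)d}$.
   Context: All graphs are simple, finite and undirected. $T^+$ denotes the graph obtained from $T$ by adding a new vertex adjacent to all vertices of $T$. $\mathrm{tw}$ denotes treewidth, $K_c$ is the complete graph on $c$ vertices, and $\boxtimes$ is the strong product: $V(G\boxtimes H)=V(G)\times V(H)$, and distinct $(v,w),(v',w')$ are adjacent iff ($v=v'$ or $vv'\in E(G)$) and ($w=w'$ or $ww'\in E(H)$). ''$G$ is contained in $J$'' means $G$ is isomorphic to a subgraph of $J$. *)

(* Defs.v *)
From mathcomp Require Import all_boot boolp.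

Set Implicit Arguments.
Unset Strict Implicit.
Unset Printing Implicit Defensive.

Record sgraph := SGraph {
  vertex :> finType;
  adj : rel vertex;
  adj_sym : symmetric adj;
  adj_irr : irreflexive adj }.

(* [connect] is the reflexive-transitive closure, and the relation below is
   adjacency in the subgraph induced by A; set0 counts as connected. *)
Definition connected_set (G : sgraph) (A : {set G}) : Prop :=
  {in A &, forall x y,
     connect [rel u v : G | [&& u \in A, v \in A & adj u v]] x y}.

Definition acyclic (G : sgraph) : Prop :=
  forall c : seq G, 2 < size c -> ~ ucycle (@adj G) c.

Definition is_tree (G : sgraph) : Prop :=
  [/\ 0 < #|G|, connected_set [set: G] & acyclic G].

Definition max_degree (G : sgraph) : nat :=
  \max_(x : G) #|[set y : G | adj x y]|.

Definition walk (G : sgraph) (k : nat) (x y : G) : bool :=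
  [exists p : k.-tuple G, path (@adj G) x p && (last x p == y)].

(* Length of a shortest walk. If y is reachable from x then some walk has
   fewer than #|G| edges; otherwise the value is #|G|. *)
Definition dist (G : sgraph) (x y : G) : nat :=
  find (fun k => walk k x y) (iota 0 #|G|).

Definition eccentricity (G : sgraph) (x : G) : nat := \max_(y : G) dist x y.

(* Every eccentricity is at most #|G|, so for nonempty G the starting value
   of the minimum is irrelevant. *)
Definition radius (G : sgraph) : nat :=
  \big[minn/#|G|]_(x : G) eccentricity x.

Record tree_decomposition (G : sgraph) := TreeDecomposition {
  td_tree : sgraph;
  td_treeP : is_tree td_tree;
  td_bag : td_tree -> {set G};
  td_vertex : forall v : G, exists i, v \in td_bag i;
  td_edge : forall u v : G, adj u v ->
    exists i, (u \in td_bag i) && (v \in td_bag i);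
  td_subtree : forall v : G, connected_set [set i | v \in td_bag i] }.

(* Maximum bag size minus one. Subtraction is truncated, which matters only
   for the empty graph: its treewidth is 0 here instead of -1. *)
Definition width (G : sgraph) (D : tree_decomposition G) : nat :=
  (\max_(i : td_tree D) #|td_bag i|).-1.

Lemma unit_adj_sym : symmetric (fun _ _ : unit => false).
Proof. by []. Qed.

Lemma unit_adj_irr : irreflexive (fun _ : unit => fun _ : unit => false).
Proof. by []. Qed.

Definition unit_graph : sgraph := SGraph unit_adj_sym unit_adj_irr.

Lemma unit_graph_tree : is_tree unit_graph.
Proof.
split; first by rewrite card_unit.
- by move=> [] [] _ _; apply: connect0.
- by case=> [|x [|y c]].
Qed.

Lemma trivial_decomposition (G : sgraph) : tree_decomposition G.
Proof.
apply: (@TreeDecomposition G unit_graph unit_graph_tree (fun _ => [set: G])).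
- by move=> v; exists tt; rewrite inE.
- by move=> u v _; exists tt; rewrite !inE.
- by move=> v [] [] _ _; apply: connect0.
Qed.

Definition has_width (G : sgraph) (k : nat) : bool :=
  `[< exists D : tree_decomposition G, width D = k >].

Lemma has_width_ex (G : sgraph) : exists k, has_width G k.
Proof.
by exists (width (trivial_decomposition G)); apply/asboolP; eexists.
Qed.

Definition treewidth (G : sgraph) : nat := ex_minn (has_width_ex G).

(* X is a minor of G: the sets B x are the branch sets of a model of X in G. *)
Definition minor (X G : sgraph) : Prop :=
  exists B : X -> {set G},
    [/\ forall x, B x != set0,
        forall x, connected_set (B x),
        forall x y, x != y -> [disjoint B x & B y] &
        forall x y, adj x y -> exists u v, [/\ u \in B x, v \in B y & adj u v]].

Definition contained (G J : sgraph) : Prop :=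
  exists f : G -> J, injective f /\ forall x y, adj x y -> adj (f x) (f y).

Section AddApex.
Variable T : sgraph.

(* None is the new vertex. *)
Definition apex_adj : rel (option T) := fun a b =>
  match a, b with
  | Some x, Some y => adj x y
  | None, None => false
  | _, _ => true
  end.

Lemma apex_adj_sym : symmetric apex_adj.
Proof. by move=> [x|] [y|] //=; apply: adj_sym. Qed.

Lemma apex_adj_irr : irreflexive apex_adj.
Proof. by move=> [x|] //=; apply: adj_irr. Qed.

Definition add_apex : sgraph := SGraph apex_adj_sym apex_adj_irr.
End AddApex.

Section Complete.
Variable c : nat.

Definition complete_adj : rel 'I_c := fun i j => i != j.

Lemma complete_adj_sym : symmetric complete_adj.
Proof. by move=> i j; rewrite /complete_adj eq_sym. Qed.

Lemma complete_adj_irr : irreflexive complete_adj.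
Proof. by move=> i; rewrite /complete_adj eqxx. Qed.

Definition complete_graph : sgraph := SGraph complete_adj_sym complete_adj_irr.
End Complete.

Section StrongProduct.
Variables G H : sgraph.

Definition strong_adj : rel (G * H) := fun p q =>
  [&& p != q, (p.1 == q.1) || adj p.1 q.1 & (p.2 == q.2) || adj p.2 q.2].

Lemma strong_adj_sym : symmetric strong_adj.
Proof.
move=> p q; rewrite /strong_adj eq_sym [q.1 == _]eq_sym [q.2 == _]eq_sym.
by rewrite [adj q.1 _]adj_sym [adj q.2 _]adj_sym.
Qed.

Lemma strong_adj_irr : irreflexive strong_adj.
Proof. by move=> p; rewrite /strong_adj eqxx. Qed.

Definition strong_product : sgraph := SGraph strong_adj_sym strong_adj_irr.
End StrongProduct.

(* Main.v *)
Require Import Defs.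
From mathcomp Require Import all_boot boolp.

(* Let A be connected, let C be disjoint from A with all its outer neighbours in
   A, and let S be the set of vertices of C adjacent to A.  A model of T in G[C]
   all of whose branch sets meet S would, with A as apex, be a model of T^+.

   Excluding such S-rooted models has two consequences.  First, Diestel's proof
   of the excluded forest theorem, applied with k = t - 1, gives a path
   decomposition of G[C] relative to S with bags of size at most 2k + 1 = 2t - 1;
   its last step joins the t branch sets to S by Menger's theorem, and a small
   separator met there is where the factor 2 comes from.  Hence, among connected
   sets meeting S, either d + 1 are disjoint or (2t - 1)d vertices hit all of
   them.  Secondly, the complete d-ary tree of depth h has no S-rooted model, and
   an induction on its depth, which grows a connected root and removes hitting
   sets one after another, places S in parts of size (2t - 1)d arranged in a tree
   decomposition with at most 2h parts per bag; everything left over avoids S and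
   attaches to a single bag.

   Each leftover piece D is enlarged by what it separates from A, so that its
   complement in A u C is connected, and is then decomposed in turn, below the
   2h parts of the bag that it attaches to.  This gives bags of 4h parts. *)

(** The bags stay bounded through the recursion because a leftover piece forgets its ancestors. It
    avoids S, so it has no neighbour in A and attaches to at most 2h parts of the current
    decomposition; the 2h parts handed down from above are carried only while the current set is
    decomposed. In return a piece must again lie opposite a connected set, which is what its
    enlargement provides. The enlargement has a cost: enlarged pieces can swallow one another as
    well as vertices already placed in parts. Hence only the pieces that no other one swallows are
    kept, and the parts are trimmed.

    The 2h parts of a single decomposition are two for each unit of depth of the excluded d-ary
    tree: the frontier of the grown root, and the hitting part just beyond it. The depth is the
    radius because T is rooted at a centre, and a vertex has at most d children. The count d + 1 of
    disjoint sets, instead of d, arises because the branch set of the root must meet S as well. *)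

Set Implicit Arguments.
Unset Strict Implicit.
Unset Printing Implicit Defensive.

(** * Connected sets and components *)

Section Connectivity.
Variable G : sgraph.
Implicit Types (A B P U : {set G}) (x y : G).

Definition adj_in U : rel G := [rel u v | [&& u \in U, v \in U & adj u v]].

(** Together with its converse [connected_setI], this lets later arguments propagate membership
    along edges instead of handling paths. *)
Lemma connected_set_sub A P x :
    connected_set A -> x \in A -> x \in P ->
    (forall u v, u \in A -> v \in A -> u \in P -> adj u v -> v \in P) ->
  A \subset P.
Proof.
move=> cA xA xP cl; apply/subsetP=> y yA.
have /connectP[s] := cA x y xA yA.
elim: s x {xA} xP => [|z s IH] x xP /=; first by move=> _ ->.
case/andP=> /and3P[xA zA xz] ps ey; apply: (IH z) => //; exact: cl xz.
Qed.

Lemma connected_setI A :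
    (forall P x, x \in A -> x \in P ->
      (forall u v, u \in A -> v \in A -> u \in P -> adj u v -> v \in P) ->
      A \subset P) ->
  connected_set A.
Proof.
move=> H x y xA yA.
suff /subsetP/(_ y yA) : A \subset [set z | connect (adj_in A) x z].
  by rewrite inE.
apply: (H _ x) => //; first by rewrite inE connect0.
move=> u v uA vA; rewrite !inE => xu uv.
by apply: connect_trans xu (connect1 _); rewrite /adj_in /= uA vA.
Qed.

Lemma connected_set1 x : connected_set [set x].
Proof. by move=> u v /set1P-> /set1P->; apply: connect0. Qed.

Lemma connected_setU A B x y :
    connected_set A -> connected_set B -> x \in A -> y \in B ->
    (x == y) || adj x y ->
  connected_set (A :|: B).
Proof.
move=> cA cB xA yB xy; apply: connected_setI => P z zAB zP cl.
have clA u v : u \in A -> v \in A -> u \in P -> adj u v -> v \in P.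
  by move=> uA vA; apply: cl; rewrite inE ?uA ?vA.
have clB u v : u \in B -> v \in B -> u \in P -> adj u v -> v \in P.
  by move=> uA vA; apply: cl; rewrite inE ?uA ?vA orbT.
have AB : A \subset P -> B \subset P.
  move=> /subsetP sA; apply: (connected_set_sub cB yB) => //.
  case/orP: xy => [/eqP<-|xy]; first exact: sA.
  by apply: cl xy; rewrite ?inE ?xA ?yB ?orbT ?sA.
have BA : B \subset P -> A \subset P.
  move=> /subsetP sB; apply: (connected_set_sub cA xA) => //.
  case/orP: xy => [/eqP->|xy]; first exact: sB.
  rewrite adj_sym in xy.
  by apply: cl xy; rewrite ?inE ?xA ?yB ?orbT ?sB.
rewrite subUset; case/setUP: zAB => zM.
  by have sA := connected_set_sub cA zM zP clA; rewrite sA AB.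
by have sB := connected_set_sub cB zM zP clB; rewrite sB BA.
Qed.

Lemma connected_set_bigcup (I : finType) A (F : I -> {set G}) :
    A != set0 -> connected_set A -> (forall i, connected_set (F i)) ->
    (forall i, exists x y, [/\ x \in A, y \in F i & adj x y]) ->
  connected_set (A :|: \bigcup_i F i).
Proof.
move=> /set0Pn[a aA] cA cF adjF.
suff: connected_set (A :|: \bigcup_i F i) /\ a \in A :|: \bigcup_i F i by case.
rewrite inE aA; split=> //.
elim/big_rec: _ => [|i B _ cB]; first by rewrite setU0.
rewrite setUCA; have [x [y [xA yF xy]]] := adjF i.
by apply: (connected_setU (cF i) cB yF (_ : x \in _));
  rewrite ?inE ?xA // adj_sym xy orbT.
Qed.

(** For [x] outside [U] this is the singleton of [x], so [component_refl] holds without a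
    hypothesis. *)
Definition component U x : {set G} := [set y | connect (adj_in U) x y].

Lemma component_refl U x : x \in component U x.
Proof. by rewrite inE connect0. Qed.

Lemma component_sub U x : x \in U -> component U x \subset U.
Proof.
move=> xU; apply/subsetP=> y; rewrite inE => /connectP[s].
elim: s x xU => [|z s IH] x xU /=; first by move=> _ ->.
by case/andP=> /and3P[_ zU _]; apply: IH.
Qed.

Lemma component_closed U x u v :
  x \in U -> u \in component U x -> v \in U -> adj u v -> v \in component U x.
Proof.
move=> xU uC vU uv; have uU := subsetP (component_sub xU) u uC.
move: uC; rewrite !inE => xu.
by apply: connect_trans xu (connect1 _); rewrite /adj_in /= uU vU.
Qed.

Lemma component_min U x P :
    x \in P ->
    (forall u v, u \in U -> v \in U -> u \in P -> adj u v -> v \in P) ->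
  component U x \subset P.
Proof.
move=> xP cl; apply/subsetP=> y; rewrite inE => /connectP[s].
elim: s x xP => [|z s IH] x xP /=; first by move=> _ ->.
case/andP=> /and3P[xU zU xz]; apply: IH.
exact: cl xz.
Qed.

Lemma adj_in_sym U : symmetric (adj_in U).
Proof. by move=> u v; rewrite /adj_in /= adj_sym andbCA. Qed.

Lemma component_connected U x : x \in U -> connected_set (component U x).
Proof.
move=> xU; apply: connected_setI => P z zC zP cl.
suff xP : x \in P.
  have := @component_min U x (P :&: component U x); rewrite inE xP component_refl => /(_ isT).
  rewrite subsetI => H; apply: proj1 (andP (H _)) => u v uU vU /setIP[uP uC] uv.
  have vC := component_closed xU uC vU uv.
  by rewrite inE vC (cl u v).
have zx : connect (adj_in U) z x.
  by rewrite (sym_connect_sym (@adj_in_sym U)); move: zC; rewrite inE.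
case/connectP: zx => s; elim: s z zC zP => [|w s IH] z zC zP /=.
  by move=> _ ->.
case/andP=> /and3P[zU wU zw]; apply: IH; first exact: component_closed zw.
by apply: (cl _ _ _ _ zP zw) => //; apply: component_closed zw.
Qed.

Lemma component_sup U x A :
  x \in A -> A \subset U -> connected_set A -> A \subset component U x.
Proof.
move=> xA /subsetP AU cA; apply: (connected_set_sub cA xA (component_refl _ _)).
by move=> u v uA vA uC; apply: component_closed; rewrite ?AU.
Qed.

Lemma set_components_ind (Q : {set G} -> Prop) U :
    Q set0 ->
    (forall U1 U2 : {set G}, U1 \subset U -> U2 \subset U -> [disjoint U1 & U2] ->
      (forall u v, u \in U1 -> v \in U2 -> ~~ adj u v) ->
      Q U1 -> Q U2 -> Q (U1 :|: U2)) ->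
    (forall K : {set G}, K \subset U -> K != set0 -> connected_set K ->
      (forall u v, u \in K -> v \in U -> adj u v -> v \in K) -> Q K) ->
  Q U.
Proof.
move=> Q0 QU QK.
(* Generalised to unions [W] of components of [U], so that a component of [W] is closed in all of
   [U]. *)
suff H n (W : {set G}) : #|W| <= n -> W \subset U ->
    (forall u v, u \in W -> v \in U -> adj u v -> v \in W) -> Q W.
  by apply: (H #|U|).
elim: n W => [|n IH] W.
  by rewrite leqn0 cards_eq0 => /eqP->.
move=> leW sW clW; have [->//|[x xW]] := set_0Vmem W.
have sC := component_sub xW.
have clC u v : u \in component W x -> v \in U -> adj u v -> v \in component W x.
  move=> uC vU uv; apply: (component_closed _ uC _ uv) => //.
  by apply: clW uv => //; apply: (subsetP sC).
have -> : W = component W x :|: (W :\: component W x).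
  by apply/setP=> y; rewrite !inE; have := subsetP sC y; rewrite inE;
     case: connect => //= ->.
apply: QU.
- exact: subset_trans sC sW.
- by apply: subset_trans sW; apply: subsetDl.
- by rewrite disjoints_subset; apply/subsetP=> y; rewrite !inE => ->.
- move=> u v uC /setDP[vW vC]; apply: contra vC => /(clC u v uC); apply.
  exact: (subsetP sW).
- apply: QK => //; first exact: subset_trans sC sW.
    by apply/set0Pn; exists x; apply: component_refl.
  exact: component_connected.
- apply: IH.
  + rewrite -ltnS; apply: leq_trans leW; apply: proper_card.
    apply: (sub_proper_trans (B := W :\ x)).
      apply/subsetP=> y; rewrite !inE => /andP[nC ->]; rewrite andbT.
      by apply: contraNN nC => /eqP->; apply: connect0.
    exact: properD1.
  + by apply: subset_trans sW; apply: subsetDl.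
  + move=> u v /setDP[uW uC] vU uv; have vW := clW u v uW vU uv.
    rewrite inE vW andbT; apply: contra uC => vC.
    by apply: component_closed vC uW _ => //; rewrite adj_sym.
Qed.

End Connectivity.

(** * Boundaries and Menger's theorem *)

Section Boundary.
Variable G : sgraph.
Implicit Types (A B Q F X Y Z W : {set G}).

(* [Q] acts as a set of vertices adjacent to an extra vertex at infinity. *)
Definition bd Q Z : {set G} :=
  [set v in Z | (v \in Q) || [exists u, (u \notin Z) && adj v u]].

Lemma bdP Q Z v :
  reflect (v \in Z /\ (v \in Q \/ exists2 u, u \notin Z & adj v u))
          (v \in bd Q Z).
Proof.
rewrite inE; apply: (iffP andP) => -[vZ H]; split=> //.
  case/orP: H => [->|/existsP[u /andP[uZ vu]]]; first by left.
  by right; exists u.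
case: H => [->//|[u uZ vu]]; apply/orP; right; apply/existsP; exists u.
by rewrite uZ.
Qed.

Lemma bd_sub Q Z : bd Q Z \subset Z.
Proof. by apply/subsetP=> v /bdP[]. Qed.

(** Submodularity of the boundary, with [Q] charged only to [A] and to the intersection. The two
    sums are compared through the union and the intersection of the boundaries on each side. *)
Lemma bd_submod Q A Z :
  #|bd Q (A :&: Z)| + #|bd set0 (A :|: Z)| <= #|bd Q A| + #|bd set0 Z|.
Proof.
rewrite -cardsUI -[X in _ <= X]cardsUI; apply: leq_add; apply: subset_leq_card.
  apply/subsetP=> v /setUP[] /bdP[vM H].
    case/setIP: vM => vA vZ; case: H => [vQ|[u uM vu]].
      by apply/setUP; left; apply/bdP; split=> //; left.
    move: uM; rewrite inE negb_and => /orP[]uM; apply/setUP; [left|right];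
      by apply/bdP; split=> //; right; exists u.
  case: H => [|[u uM vu]]; first by rewrite inE.
  move: uM; rewrite inE negb_or => /andP[uA uZ].
  by case/setUP: vM => vM; apply/setUP; [left|right]; apply/bdP; split=> //;
     right; exists u.
apply/subsetP=> v /setIP[/bdP[/setIP[vA vZ] _]] /bdP[_ [|[u uM vu]]].
  by rewrite inE.
move: uM; rewrite inE negb_or => /andP[uA uZ].
by apply/setIP; split; apply/bdP; split=> //; right; exists u.
Qed.

Lemma bdU1 Q X y : bd Q (y |: X) \subset y |: bd Q X.
Proof.
apply/subsetP=> v /bdP[/setU1P[->|vX] H]; first by rewrite setU11.
apply/setU1P; right; apply/bdP; split=> //.
case: H => [|[u uX vu]]; [by left|right].
by exists u => //; apply: contra uX => uX; rewrite inE uX orbT.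
Qed.

(** Disjoint paths from [A] to [B], relaxed to connected sets indexed by their starting vertices, so
    that they merge directly with branch sets. *)
Definition linkage A B W (f : G -> {set G}) : Prop :=
  (forall x, x \in A -> [/\ x \in f x, connected_set (f x), f x \subset W &
                            exists2 z, z \in f x & z \in B]) /\
  {in A &, forall x y, x != y -> [disjoint f x & f y]}.

Lemma disjointP_in A B (x : G) : [disjoint A & B] -> x \in A -> x \in B -> False.
Proof. by move=> /pred0P/(_ x) /= H xA xB; rewrite xA xB in H. Qed.

Lemma linkage_end_uniq A B W f x x' z :
    linkage A B W f -> x \in A -> x' \in A -> z \in f x -> z \in f x' -> x = x'.
Proof.
move=> [_ dj] xA x'A zx zx'; apply: contraTeq isT => ne.
by have := disjointP_in (dj x x' xA x'A ne) zx zx'.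
Qed.

(** A choice of ends is injective by disjointness, hence onto [B] by cardinality; so each connected
    set meets [B] in its chosen end only. *)
Lemma linkage_ends A B W f :
    linkage A B W f -> #|B| <= #|A| ->
  exists2 g : G -> G, {in A, forall x, g x \in f x /\ g x \in B} &
    {in B, forall z x, x \in A -> z \in f x -> z = g x}.
Proof.
move=> lk leBA; have [lk1 lk2] := lk.
have /choice[g gP] : forall x, exists z, x \in A -> z \in f x /\ z \in B.
  move=> x; case: (boolP (x \in A)) => [xA|_]; last by exists x.
  by have [_ _ _ [z zf zB]] := lk1 x xA; exists z.
exists g => [//|z zB x xA zx].
have gi : {in A &, injective g}.
  move=> u v uA vA guv; apply: (linkage_end_uniq lk uA vA (z := g u)).
    by case: (gP u uA).
  by rewrite guv; case: (gP v vA).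
have /eqP gB : g @: A == B.
  rewrite eqEcard card_in_imset // leBA andbT.
  by apply/subsetP=> _ /imsetP[u uA ->]; case: (gP u uA).
move: (zB); rewrite -gB => /imsetP[u uA zE].
rewrite zE; congr g; apply: (linkage_end_uniq lk uA xA _ zx).
by rewrite zE; case: (gP u uA).
Qed.

(* Menger's theorem, with the vertices of [F] deleted.  A set Z strictly
   between X and Y whose boundary is as small as that of X splits the problem;
   otherwise a vertex x of the boundary can be traded for a neighbour in Y. *)
Lemma menger Q F X Y :
    X \subset Y -> F \subset X ->
    (forall Z, X \subset Z -> Z \subset Y ->
      #|bd Q X :\: F| <= #|bd Q Z :\: F|) ->
  exists f, linkage (bd Q X :\: F) (bd Q Y :\: F)
                    ((Y :\: X) :|: (bd Q X :\: F)) f.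
Proof.
have [n] := ubnP #|Y :\: X|; elim: n F X Y => // n IH F X Y; rewrite ltnS.
move=> len XY FX minX.
have [sub|/subsetPn[x xX xY]] :=
    boolP (bd Q X :\: F \subset bd Q Y :\: F).
  exists (fun x => [set x]); split=> [x xX|x y _ _ xy].
    split; rewrite ?set11 //; first exact: connected_set1.
      by rewrite sub1set inE xX orbT.
    by exists x; rewrite ?set11 ?(subsetP sub).
  by rewrite disjoints1 inE.
case: (boolP [exists Z : {set G}, [&& X \proper Z, Z \proper Y &
           #|bd Q Z :\: F| <= #|bd Q X :\: F|]]).
  case/existsP=> Z /and3P[XZ ZY leZ].
  have sXZ := proper_sub XZ; have sZY := proper_sub ZY.
  have cardZ : #|bd Q Z :\: F| = #|bd Q X :\: F|.
    by apply/eqP; rewrite eqn_leq leZ minX.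
  have [z0 z0Y z0Z] : exists2 z, z \in Y & z \notin Z by case/properP: ZY.
  have [z1 z1Z z1X] : exists2 z, z \in Z & z \notin X by case/properP: XZ.
  have z0X : z0 \notin X by apply: contra z0Z; apply: (subsetP sXZ).
  have z1Y : z1 \in Y by apply: (subsetP sZY).
  have [|W XW WZ|f lf] := IH F X Z _ sXZ FX.
  - apply: leq_trans len; apply: proper_card; apply/properP; split.
      exact: setSD.
    by exists z0; rewrite inE ?z0X ?(negPf z0Z) ?andbF.
  - by apply: minX => //; apply: subset_trans sZY.
  have [||W ZW WY|f' lf'] := IH F Z Y _ sZY.
  - apply: leq_trans len; apply: proper_card; apply/properP; split.
      exact: setDS.
    by exists z1; rewrite inE ?z1X ?z1Z.
  - exact: subset_trans sXZ.
  - by rewrite cardZ; apply: minX => //; apply: subset_trans ZW.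
  have [g gP gU] := linkage_ends lf leZ.
  have fZ u : u \in bd Q X :\: F -> f u \subset Z.
    move=> uX; have [_ _ sf _] := lf.1 u uX; apply: subset_trans sf _.
    rewrite subUset subsetDl; apply: subset_trans (subsetDl _ _) _.
    exact: subset_trans (bd_sub _ _) sXZ.
  (* The sets of the first linkage stay in [Z], and those of the second meet [Z] only in its
     boundary, where each vertex starts its own set. *)
  have cross u v w : u \in bd Q X :\: F -> v \in bd Q X :\: F ->
      w \in f u -> w \in f' (g v) -> u = v.
    move=> uX vX wu wv; have [guf guZ] := gP u uX; have [gvf gvZ] := gP v vX.
    have [_ _ sv _] := lf'.1 _ gvZ.
    have wZ : w \in bd Q Z :\: F.
      have /setUP[/setDP[_ /negP[]]//|//] := subsetP sv w wv.
      exact: (subsetP (fZ u uX)).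
    have [ww _ _ _] := lf'.1 w wZ.
    have wE := linkage_end_uniq lf' wZ gvZ ww wv.
    by apply: (linkage_end_uniq lf uX vX wu); rewrite wE.
  exists (fun x => f x :|: f' (g x)); split=> [u uX|u v uX vX uv].
    have [uf cf sf _] := lf.1 u uX; have [guf guZ] := gP u uX.
    have [gg cg sg [z zf zY]] := lf'.1 (g u) guZ.
    split.
    + by rewrite inE uf.
    + by apply: (connected_setU cf cg guf gg); rewrite eqxx.
    + rewrite subUset; apply/andP; split.
        by apply: subset_trans sf _; apply: setSU; apply: setSD.
      apply/subsetP=> w wg; have /setUP[/setDP[wY wZ]|wZ] := subsetP sg w wg.
        rewrite 2!inE wY andbT; apply/orP; left; apply: contra wZ.
        exact: (subsetP sXZ).
      have [ww _ _ _] := lf'.1 w wZ.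
      rewrite (linkage_end_uniq lf' wZ guZ ww wg).
      have /setUP[/setDP[gZ gX]|gX] := subsetP sf _ guf.
        by rewrite 2!inE gX (subsetP sZY).
      by apply/setUP; right.
    + by exists z; rewrite // inE zf orbT.
  apply/pred0P=> w /=; apply/negP=> /andP[/setUP[]wu /setUP[]wv].
  - by case/eqP: uv; apply: (linkage_end_uniq lf uX vX wu wv).
  - by case/eqP: uv; apply: cross wu wv.
  - by case/eqP: uv; apply/esym; apply: cross wv wu.
  have [guf guZ] := gP u uX; have [gvf gvZ] := gP v vX.
  have gE := linkage_end_uniq lf' guZ gvZ wu wv.
  by case/eqP: uv; apply: (linkage_end_uniq lf uX vX guf); rewrite gE.
move=> noZ; have [xbX xF] := setDP xX; have [xXX _] := bdP _ _ _ xbX.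
have [y [yY yX xy]] : exists y, [/\ y \in Y, y \notin X & adj x y].
  have xbY : x \notin bd Q Y by apply: contra xY => xY; rewrite inE xF.
  case/bdP: xbX => _ [xQ|[y yX xy]].
    by case/bdP: xbY; split; [apply: (subsetP XY)|left].
  exists y; split=> //; apply: contraR xbY => yY.
  by apply/bdP; split; [apply: (subsetP XY)|right; exists y].
have yF : y \notin F by apply: contra yX; apply: (subsetP FX).
have xney : x != y by apply: contraNneq yX => <-.
have sub1 : bd Q (y |: X) :\: (x |: F) \subset y |: (bd Q X :\: F) :\ x.
  apply/subsetP=> w /setDP[/(subsetP (bdU1 _ _ _)) /setU1P[->|wX]].
    by rewrite setU11.
  rewrite in_setU1 negb_or => /andP[wx wF]; apply/setU1P; right.
  by apply/setD1P; split=> //; apply/setDP.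
have card1 : #|y |: (bd Q X :\: F) :\ x| = #|bd Q X :\: F|.
  have yN : y \notin (bd Q X :\: F) :\ x.
    by apply: contra yX => /setD1P[_ /setDP[/bdP[]]].
  by rewrite cardsU1 yN add1n (cardsD1 x (bd Q X :\: F)) xX.
(* Deleting [x] costs at most one boundary vertex. For [Z = Y] it costs none, as [x] is not on the
   boundary of [Y]; for a smaller [Z] the excluded case leaves one vertex to spare. *)
have min1 Z : y |: X \subset Z -> Z \subset Y ->
    #|bd Q X :\: F| <= #|bd Q Z :\: (x |: F)|.
  rewrite subUset sub1set => /andP[yZ XZ] ZY.
  have -> : bd Q Z :\: (x |: F) = (bd Q Z :\: F) :\ x.
    by rewrite setDDl setUC.
  have [ZE|ZE] := eqVneq Z Y.
    have /setDidPl -> : [disjoint bd Q Z :\: F & [set x]].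
      by rewrite disjoint_sym disjoints1 ZE.
    exact: minX.
  have : #|bd Q X :\: F| < #|bd Q Z :\: F|.
    rewrite ltnNge; apply: contra noZ => leZ; apply/existsP; exists Z.
    rewrite leZ andbT; apply/andP; split.
      by apply/properP; split=> //; exists y.
    by rewrite properEneq ZE.
  rewrite (cardsD1 x (bd Q Z :\: F)); case: (x \in bd Q Z :\: F).
    by rewrite add1n ltnS.
  by rewrite add0n => /ltnW.
have E1 : bd Q (y |: X) :\: (x |: F) = y |: (bd Q X :\: F) :\ x.
  apply/eqP; rewrite eqEcard sub1 card1; apply: min1 => //.
  by rewrite subUset sub1set yY.
have [|||Z XZ ZY|f [lf1 lf2]] := IH (x |: F) (y |: X) Y.
- apply: leq_trans len; apply: proper_card; apply/properP; split.
    by apply: setDS; apply: subsetUr.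
  by exists y; rewrite !inE ?eqxx ?yX.
- by rewrite subUset sub1set yY.
- rewrite subUset sub1set !inE xXX orbT /=.
  by apply: subset_trans FX _; apply: subsetUr.
- by rewrite E1 card1; apply: min1.
rewrite E1 in lf1 lf2.
have yA : y \in y |: (bd Q X :\: F) :\ x by rewrite setU11.
have inA u : u \in bd Q X :\: F -> u != x -> u \in y |: (bd Q X :\: F) :\ x.
  by move=> uX ux; apply/setU1P; right; apply/setD1P.
have xNf u : u \in y |: (bd Q X :\: F) :\ x -> x \notin f u.
  move=> uA; have [_ _ sf _] := lf1 u uA; apply/negP=> /(subsetP sf).
  by rewrite !inE xXX eqxx (negPf xney) ?orbT ?andbF.
have subW u : u \in y |: (bd Q X :\: F) :\ x ->
    f u \subset Y :\: X :|: bd Q X :\: F.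
  move=> uA; have [_ _ sf _] := lf1 u uA; apply: subset_trans sf _.
  apply/subsetP=> w /setUP[/setDP[wY /setU1P/not_orP[_ /negP wX]]|].
    by rewrite 2!inE wX wY.
  case/setU1P=> [->|/setD1P[_ wX]]; first by rewrite 2!inE yX yY.
  by apply/setUP; right.
have meet u : u \in y |: (bd Q X :\: F) :\ x ->
    exists2 z, z \in f u & z \in bd Q Y :\: F.
  move=> uA; have [_ _ _ [z zf /setDP[zY zF]]] := lf1 u uA.
  exists z; rewrite // inE zY andbT; apply: contra zF => zF.
  by rewrite inE zF orbT.
exists (fun u => if u == x then x |: f y else f u).
split=> [u uX|u v uX vX uv].
  case: eqP => [->|/eqP ux]; last first.
    by have [uf cf _ _] := lf1 u (inA u uX ux); split=> //;
       [apply: subW (inA u uX ux) | apply: meet (inA u uX ux)].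
  have [yf cf _ _] := lf1 y yA; split.
  - by rewrite setU11.
  - by apply: (connected_setU (@connected_set1 G x) cf (set11 x) yf); rewrite xy orbT.
  - by rewrite subUset subW // andbT sub1set inE xX orbT.
  - by have [z zf zY] := meet y yA; exists z; rewrite // inE zf orbT.
have djx w : w \in bd Q X :\: F -> w != x -> [disjoint x |: f y & f w].
  move=> wX wx; have wA := inA w wX wx.
  rewrite -setI_eq0 setIUl setU_eq0 !setI_eq0 disjoints1 xNf //=.
  apply: lf2 => //; apply: contraNneq yX => ->.
  by case/setDP: wX => /bdP[].
case: eqP => [ux|/eqP ux]; case: eqP => [vx|/eqP vx].
- by rewrite ux vx eqxx in uv.
- exact: djx.
- by rewrite disjoint_sym; apply: djx.
- by apply: lf2; rewrite ?inA.
Qed.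
End Boundary.

(** * Rooted models of trees *)

Definition rooted_tree (T : sgraph) (c : T) (p : T -> T) (l : T -> nat) : Prop :=
  (forall v, v != c -> l v = (l (p v)).+1) /\
  (forall u v, adj u v -> (u != c /\ p u = v) \/ (v != c /\ p v = u)).

Definition rooted_model (T G : sgraph) (S : {set G}) (B : T -> {set G}) : Prop :=
  [/\ forall x, connected_set (B x),
      forall x, exists2 s, s \in B x & s \in S,
      forall x y, x != y -> [disjoint B x & B y] &
      forall x y, adj x y -> exists u v, [/\ u \in B x, v \in B y & adj u v]].

(** * Sweeps: path decompositions relative to a vertex set *)

Section Sweep.
Variables (G : sgraph) (S : {set G}) (k : nat).
Implicit Types (X Y Z W : {set G}).

(* A sweep is a chain of sets; the step from X to Y corresponds to the bag
   [bd set0 X :|: bd (S :\: X) Y] of a path decomposition, and the components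
   of what is left of [Y :\: X] avoid S and attach to that bag only. *)
Inductive sweep : {set G} -> Prop :=
| sweep0 : sweep set0
| sweepS X Y : sweep X -> X \subset Y -> #|bd set0 Y| <= k ->
    #|bd (S :\: X) Y| <= k.+1 -> sweep Y.

Lemma sweep_bd X : sweep X -> #|bd set0 X| <= k.
Proof.
by case=> // ; rewrite (_ : bd _ _ = set0) ?cards0 //; apply/eqP;
   rewrite -subset0 bd_sub.
Qed.

Lemma bd0_sub (Q Z : {set G}) : bd set0 Z \subset bd Q Z.
Proof.
apply/subsetP=> v /bdP[vZ [|H]]; first by rewrite inE.
by apply/bdP; split=> //; right.
Qed.

(** The whole sweep is intersected with [Z]. As [X :|: Z] has at least as large a boundary as [Z],
    submodularity gives [X :&: Z] at most the boundary of [X]. *)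
Lemma sweep_restrict Y Z :
    sweep Y -> Z \subset Y ->
    (forall W, Z \subset W -> W \subset Y -> #|bd set0 Z| <= #|bd set0 W|) ->
  sweep Z.
Proof.
move=> swY ZY minZ.
have le Q X : X \subset Y -> #|bd Q (X :&: Z)| <= #|bd Q X|.
  move=> XY; have := bd_submod Q X Z.
  have := minZ (X :|: Z); rewrite subsetUr subUset XY ZY => /(_ isT isT) leZ leXZ.
  rewrite -(leq_add2r #|bd set0 (X :|: Z)|); apply: leq_trans leXZ _.
  by rewrite leq_add2l.
suff H X : sweep X -> X \subset Y -> sweep (X :&: Z).
  by have := H Y swY (subxx _); rewrite (setIidPr ZY).
elim=> {X} [|X X' swX IH XX' bdX' bdX] sX'; first by rewrite set0I; apply: sweep0.
have sX := subset_trans XX' sX'.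
apply: (sweepS (IH sX)); first exact: setSI.
  exact: leq_trans (le _ _ sX') bdX'.
apply: leq_trans bdX; apply: leq_trans (le _ _ sX'); apply: subset_leq_card.
apply/subsetP=> v /bdP[vM H]; apply/bdP; split=> //.
case: H => [/setDP[vS vX]|]; last by right.
left; rewrite inE vS andbT; apply: contra vX => vX.
by rewrite inE vX; case/setIP: vM.
Qed.

Variables (T : sgraph) (c : T) (p : T -> T) (l : T -> nat).
Hypothesis rT : rooted_tree c p l.

(** [D] is closed under parents, so a missing vertex of least level can be added next; [E] is the
    frontier from which every branch set can still grow. *)
Definition partial_model (D : {set T}) (B : T -> {set G}) (W E : {set G}) :=
  [/\ forall u, u \in D -> [/\ connected_set (B u), B u \subset W &
                               exists2 z, z \in B u & z \in E],
      {in D &, forall u v, u != v -> [disjoint B u & B v]},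
      forall u, u \in D -> u != c -> p u \in D &
      forall u, u \in D -> u != c ->
        exists a b, [/\ a \in B u, b \in B (p u) & adj a b]].

(** The branch sets lie in [X] and a linking set meets [X] only in the boundary vertex where it
    starts, so it touches no branch set but the one that it extends. *)
Lemma partial_model_link D B X Y E f :
    partial_model D B X (bd set0 X) -> X \subset Y ->
    linkage (bd set0 X) E ((Y :\: X) :|: bd set0 X) f ->
  exists B', partial_model D B' Y E.
Proof.
move=> [B1 B2 B3 B4] XY lf; have [lf1 lf2] := lf.
have /choice[B' B'P] : forall u, exists C, u \in D ->
    exists z, [/\ z \in B u, z \in bd set0 X & C = B u :|: f z].
  move=> u; case: (boolP (u \in D)) => [uD|_]; last by exists set0.
  by have [_ _ [z zB zX]] := B1 u uD; exists (B u :|: f z) => _; exists z.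
have cross u v z w : u \in D -> v \in D -> z \in bd set0 X -> z \in B v ->
    w \in B u -> w \in f z -> u = v.
  move=> uD vD zX zv wu wz; have [_ sB _] := B1 u uD.
  have [_ _ sf _] := lf1 z zX.
  have wX : w \in bd set0 X.
    have /setUP[/setDP[_ /negP[]]|//] := subsetP sf w wz.
    exact: (subsetP sB).
  have [ww _ _ _] := lf1 w wX; have wE := linkage_end_uniq lf wX zX ww wz.
  apply: contraTeq isT => uv; rewrite -wE in zv.
  by have := disjointP_in (B2 u v uD vD uv) wu zv.
exists B'; split=> // [u uD|u v uD vD uv|u uD uc].
- have [z [zB zX ->]] := B'P u uD; have [cB sB _] := B1 u uD.
  have [zf cf sf [e ef eE]] := lf1 z zX; split.
  + by apply: (connected_setU cB cf zB zf); rewrite eqxx.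
  + rewrite subUset (subset_trans sB XY); apply: subset_trans sf _.
    by rewrite subUset subsetDl (subset_trans (bd_sub _ _) XY).
  + by exists e; rewrite // inE ef orbT.
- have [z [zB zX ->]] := B'P u uD; have [y [yB yX ->]] := B'P v vD.
  apply/pred0P=> w /=; apply/negP=> /andP[/setUP[]wu /setUP[]wv].
  + exact: disjointP_in (B2 u v uD vD uv) wu wv.
  + by case/eqP: uv; apply: cross wu wv.
  + by case/eqP: uv; apply/esym; apply: cross wv wu.
  + have zy := linkage_end_uniq lf zX yX wu wv; rewrite -zy in yB.
    exact: disjointP_in (B2 u v uD vD uv) zB yB.
- have [a [b [aB bB ab]]] := B4 u uD uc; exists a, b.
  have [z [_ _ ->]] := B'P u uD; have [y [_ _ ->]] := B'P (p u) (B3 u uD uc).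
  by rewrite !inE aB bB.
Qed.

(** The tree vertex is one of least level outside [D], so its parent is present. The branch set of
    the parent reaches the boundary of [X], which supplies the neighbour [y] outside [X]. *)
Lemma partial_model_add D B X :
    partial_model D B X (bd set0 X) -> D != setT -> X != setT ->
  exists u y B', [/\ u \notin D, y \notin X &
    partial_model (u |: D) B' (y |: X) (y |: bd set0 X)].
Proof.
move=> [B1 B2 B3 B4] DT XT.
have [u0 u0D] : exists u, u \notin D.
  by apply/existsP; rewrite -negb_forall; apply: contra DT => /forallP H;
     apply/eqP/setP=> u; rewrite inE H.
have [u uD umin] := @arg_minnP _ u0 (fun u => u \notin D) l u0D.
have puD : u != c -> p u \in D.
  move=> uc; apply: contraTT (leqnn (l u)) => puD.
  by have := umin _ puD; rewrite (rT.1 u uc) ltnn.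
have [y [yX yadj]] : exists y, y \notin X /\
    (u != c -> exists2 b, b \in B (p u) & adj y b).
  have [uc|uc] := eqVneq u c.
    have [y yX] : exists y, y \notin X.
      by apply/existsP; rewrite -negb_forall; apply: contra XT => /forallP H;
         apply/eqP/setP=> y; rewrite inE H.
    by exists y.
  have [_ _ [z zB /bdP[_ [|[y yX zy]]]]] := B1 _ (puD uc); first by rewrite inE.
  by exists y; split=> // _; exists z; rewrite // adj_sym.
exists u, y, (fun v => if v == u then [set y] else B v); split=> //.
have neD v : v \in D -> v == u = false.
  by move=> vD; apply: contraNF uD => /eqP<-.
have yB v : v \in D -> y \notin B v.
  by move=> vD; have [_ sB _] := B1 v vD; apply: contra yX; apply: (subsetP sB).
split.
- move=> v /setU1P[->|vD].
    rewrite eqxx; split; first exact: connected_set1.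
      by rewrite sub1set setU11.
    by exists y; rewrite ?set11 ?setU11.
  rewrite neD //; have [cB sB [z zB zX]] := B1 v vD; split=> //.
    by apply: subset_trans sB _; apply: subsetUr.
  by exists z; rewrite // inE zX orbT.
- move=> v w /setU1P[->|vD] /setU1P[->|wD] vw; rewrite ?eqxx ?neD //.
  + by rewrite eqxx in vw.
  + by rewrite disjoints1 yB.
  + by rewrite disjoint_sym disjoints1 yB.
  + exact: B2.
- move=> v /setU1P[->|vD] vc; apply/setU1P; right; first exact: puD.
  exact: B3.
- move=> v /setU1P[->|vD] vc.
    have [b bB yb] := yadj vc; exists y, b.
    by rewrite eqxx neD ?set11 ?puD.
  by rewrite !neD ?B3 //; apply: B4.
Qed.

Lemma partial_model_total B E :
  partial_model setT B setT E -> rooted_model E B.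
Proof.
case=> B1 B2 _ B4; split=> [x|x|x y|x y].
- by have [] := B1 x (in_setT _).
- by have [] := B1 x (in_setT _).
- by apply: B2; rewrite inE.
case/rT.2 => -[uc <-]; first by apply: B4; rewrite ?inE.
have [a [b [aB bB ab]]] := B4 y (in_setT _) uc.
by exists b, a; rewrite adj_sym.
Qed.

Definition maximal_sweep i X :=
  sweep X /\ forall Y, sweep Y -> X \subset Y -> #|bd set0 Y| <= i -> Y = X.

Lemma maximal_sweep_exists i X :
    sweep X -> #|bd set0 X| <= i ->
  exists Y, [/\ maximal_sweep i Y, X \subset Y & #|bd set0 Y| <= i].
Proof.
move=> swX leX.
pose P := [pred Y : {set G} | `[< sweep Y >] && (#|bd set0 Y| <= i)].
have PX : P X by rewrite /P /= leX andbT; apply/asboolP.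
have [Y /maxsetP[/andP[/asboolP swY leY] maxY] XY] := maxset_exists PX.
exists Y; split=> //; split=> // Z swZ YZ leZ; apply: maxY => //.
by rewrite /P /= leZ andbT; apply/asboolP.
Qed.

(** A new branch set is added just outside the maximal sweep [X]; the result is extended to a
    maximal sweep with boundary [i.+1], and Menger's theorem carries the branch sets to the new
    frontier. A separator of size at most [i] would yield a sweep contradicting the maximality of
    [X]. *)
Lemma sweep_model i :
    ~ sweep setT -> i < #|T| -> i <= k ->
  exists (D : {set T}) B X, [/\ #|D| = i, maximal_sweep i X, #|bd set0 X| = i &
                    partial_model D B X (bd set0 X)].
Proof.
move=> nsw; elim: i => [|i IH] ltT lek.
  have bd0 : #|bd set0 (set0 : {set G})| <= 0.
    by rewrite leqn0 cards_eq0 -subset0 bd_sub.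
  have [X [mX _ leX]] := maximal_sweep_exists sweep0 bd0.
  exists set0, (fun _ => set0), X; split=> //; first by rewrite cards0.
    by apply/eqP; rewrite -leqn0.
  by split=> [u|u v|u|u]; rewrite inE.
have [|D [B [X [cD [swX mX] cX pm]]]] := IH _ (ltnW lek); first exact: ltnW.
have XT : X != setT by apply/eqP=> XT; rewrite XT in swX.
have DT : D != setT by apply/eqP=> DT; move: ltT; rewrite -cardsT -DT cD ltnNge leqnSn.
have [u [y [B' [uD yX pm']]]] := partial_model_add pm DT XT.
have sX' := bdU1 set0 X y.
have cyX : #|y |: bd set0 X| <= i.+1 by rewrite cardsU1 cX; case: (_ \notin _).
have swX' : sweep (y |: X).
  apply: (sweepS swX); rewrite ?subsetUr //.
    by apply: leq_trans (leq_trans (subset_leq_card sX') cyX) lek.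
  apply: leq_trans (_ : i.+1 <= _); last exact: leqW.
  apply: leq_trans cyX; apply: subset_leq_card; apply/subsetP=> v /bdP[vM H].
  case: H => [/setDP[_ vX]|H].
    by case/setU1P: vM vX => [->|->//]; rewrite setU11.
  by apply: (subsetP sX'); apply/bdP; split=> //; right.
have bigger Z : y |: X \subset Z -> sweep Z -> i < #|bd set0 Z|.
  move=> sZ swZ; rewrite ltnNge; apply/negP=> leZ.
  have ZE := mX Z swZ (subset_trans (subsetUr _ _) sZ) leZ.
  by case/negP: yX; rewrite -ZE (subsetP sZ) // setU11.
have eX' : bd set0 (y |: X) = y |: bd set0 X.
  apply/eqP; rewrite eqEcard sX'; apply: leq_trans cyX _.
  exact: bigger.
have cX' : #|bd set0 (y |: X)| = i.+1.
  by apply/eqP; rewrite eqn_leq bigger // andbT eX'.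
have [Y [mY XY leY]] := maximal_sweep_exists swX' (eq_leq cX').
have cY : #|bd set0 Y| = i.+1.
  by apply/eqP; rewrite eqn_leq leY bigger //; case: mY.
(* [sweep_restrict] asks for a minimum boundary, hence the passage from [Z] to the minimiser
   [Z0]. *)
have minX Z : y |: X \subset Z -> Z \subset Y -> i.+1 <= #|bd set0 Z|.
  move=> XZ ZY.
  have [Z0 /andP[XZ0 ZY0] minZ0] := @arg_minnP _ Z
    (fun Z => (y |: X \subset Z) && (Z \subset Y)) (fun Z => #|bd set0 Z|)
    (introT andP (conj XZ ZY)).
  apply: leq_trans (minZ0 Z _); last by rewrite XZ.
  apply: bigger => //; apply: sweep_restrict mY.1 ZY0 _ => W ZW WY.
  by apply: minZ0; rewrite WY (subset_trans XZ0 ZW).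
have [Z XZ ZY|f] := menger XY (sub0set _) (Q := set0).
  by rewrite !setD0 cX'; apply: minX.
rewrite !setD0 => lf; rewrite -eX' in pm'.
have [B'' pm''] := partial_model_link pm' XY lf.
exists (u |: D), B'', Y; split=> //.
by rewrite cardsU1 uD cD.
Qed.

(** Once [k] branch sets sit on a maximal sweep [X], the last one is added and all are linked to
    [S]. A separator [Z] of size at most [k] would make the step from [X] to [Z] a legal sweep
    step. *)
Lemma sweep_or_model :
  #|T| = k.+1 -> sweep setT \/ exists B : T -> {set G}, rooted_model S B.
Proof.
move=> cT; have [sw|nsw] := pselect (sweep setT); [by left|right].
have [||D [B [X [cD [swX mX] cX pm]]]] := @sweep_model k nsw; rewrite ?cT //.
have XT : X != setT by apply/eqP=> XT; rewrite XT in swX.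
have DT : D != setT by apply/eqP=> DT; move: cD; rewrite DT cardsT cT => /eqP; rewrite eqn_leq ltnn.
have [u [y [B' [uD yX pm']]]] := partial_model_add pm DT XT.
have uDT : u |: D = setT.
  by apply/eqP; rewrite eqEcard subsetT cardsT cT cardsU1 uD cD add1n ltnSn.
have sX' := bdU1 set0 X y.
have cyX : #|y |: bd set0 X| <= k.+1 by rewrite cardsU1 cX; case: (_ \notin _).
have notmax Z : y |: X \subset Z -> #|bd set0 Z| <= k ->
    k.+1 < #|bd (S :\: X) Z|.
  move=> sZ leZ; rewrite ltnNge; apply/negP=> leZ'.
  have sXZ := subset_trans (subsetUr _ _) sZ.
  have ZE := mX Z (sweepS swX sXZ leZ leZ') sXZ leZ.
  by case/negP: yX; rewrite -ZE (subsetP sZ) // setU11.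
have sbd : bd (S :\: X) (y |: X) \subset y |: bd set0 X.
  apply/subsetP=> v /bdP[vM H].
  case: H => [/setDP[_ vX]|H].
    by case/setU1P: vM vX => [->|->//]; rewrite setU11.
  by apply: (subsetP sX'); apply/bdP; split=> //; right.
have gtX' : k < #|bd set0 (y |: X)|.
  rewrite ltnNge; apply/negP=> leX'; have := notmax _ (subxx _) leX'.
  by rewrite ltnNge (leq_trans (subset_leq_card sbd) cyX).
have eX' : bd set0 (y |: X) = y |: bd set0 X.
  by apply/eqP; rewrite eqEcard sX'; apply: leq_trans cyX gtX'.
have cX' : #|bd set0 (y |: X)| = k.+1.
  by apply/eqP; rewrite eqn_leq gtX' eX' cyX.
(* Removing the swept interior from [S] keeps the sources of the linkage down to the [k.+1] boundary
   vertices. No bag is underestimated: [y] is itself a boundary vertex, so [S :\: X] lies in [Q]. *)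
pose Q := S :\: ((y |: X) :\: bd set0 (y |: X)).
have bdQ : bd Q (y |: X) = bd set0 (y |: X).
  apply/eqP; rewrite eqEsubset bd0_sub andbT; apply/subsetP=> v /bdP[vM H].
  case: H => [|H]; last by apply/bdP; split=> //; right.
  by rewrite /Q in_setD in_setD vM andbT negbK => /andP[].
have [Z XZ _|f] := menger (subsetT (y |: X)) (sub0set _) (Q := Q).
  rewrite !setD0 bdQ cX' ltnNge; apply/negP=> leZ.
  have leZ0 := leq_trans (subset_leq_card (bd0_sub Q Z)) leZ.
  have := notmax Z XZ leZ0; rewrite ltnNge => /negP[].
  apply: leq_trans (leqW leZ); apply: subset_leq_card.
  apply/subsetP=> v /bdP[vZ H]; apply/bdP; split=> //.
  case: H => [/setDP[vS vX]|]; [left|by right].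
  rewrite /Q inE vS andbT inE negb_and negbK.
  have [->|vy] := eqVneq v y; first by rewrite eX' setU11.
  by rewrite in_setU1 (negPf vy) (negPf vX) orbT.
rewrite !setD0 bdQ => lf; rewrite -eX' in pm'.
have [B'' pm''] := partial_model_link pm' (subsetT _) lf.
rewrite uDT in pm''; have [B1 B2 B3 B4] := partial_model_total pm''.
exists B''; split=> // x; have [s sB /bdP[_ [/setDP[sS _]|[v]]]] := B2 x.
  by exists s.
by rewrite inE.
Qed.
End Sweep.

(** * Hitting sets obtained from a sweep *)

Section Hitting.
Variables (G : sgraph) (S : {set G}) (k : nat).
Implicit Types (F H X : {set G}).

Lemma connected_set_cut F X v :
    connected_set F -> [disjoint bd set0 X & F] -> v \in F -> v \in X ->
  F \subset X.
Proof.
move=> cF dj vF vX; apply: (connected_set_sub cF vF vX) => x y xF yF xX xy.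
apply: contraT => yX; have xb : x \in bd set0 X.
  by apply/bdP; split=> //; right; exists y.
by case: (disjointP_in dj xb xF).
Qed.

(* Greedy choice along the sweep: a member is added when it first fits in the
   swept set and avoids the current hitting set, which then gains a bag. *)
Lemma sweep_hitting_aux (fam : {set G} -> Prop) X :
    (forall F, fam F -> connected_set F /\ exists2 s, s \in F & s \in S) ->
    sweep S k X ->
  exists (r : seq {set G}) H,
    [/\ forall F, F \in r -> fam F,
        pairwise (fun F F' => [disjoint F & F']) r,
        #|H| <= size r * (2 * k).+1,
        forall F, fam F -> F \subset X -> ~~ [disjoint H & F] &
        forall F F', fam F -> [disjoint H & F] -> F' \in r -> [disjoint F & F']].
Proof.
move=> famP; elim=> [|{}X Y swX [r [H [r1 r2 r3 r4 r5]]] XY bdY bdXY].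
  exists [::], set0; split=> //; first by rewrite cards0.
  move=> F /famP[_ [s sF _]]; rewrite subset0 => /eqP F0.
  by rewrite F0 inE in sF.
have [all|] := pselect (forall F, fam F -> F \subset Y -> ~~ [disjoint H & F]).
  by exists r, H; split.
case/existsNP=> F /not_implyP[famF] /not_implyP[FY] /negP; rewrite negbK => HF.
pose bag := bd set0 X :|: bd (S :\: X) Y.
(* A member avoiding the boundary of [Y] and meeting [Y] lies inside [Y]. Its vertex [s] of [S] is
   then either new, hence in the bag, or in [X], which traps the member in [X], where [H] already
   hits it. *)
have disjbag F' : fam F' -> [disjoint (H :|: bag) & F'] -> [disjoint Y & F'].
  move=> famF' dj; apply/pred0P=> v /=; apply/negP=> /andP[vY vF'].
  have [cF' [s sF' sS]] := famP F' famF'.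
  have sub (B : {set G}) : B \subset H :|: bag -> [disjoint B & F'].
    by move=> sB; apply: disjointWl dj; apply: sB.
  have F'Y : F' \subset Y.
    apply: (connected_set_cut cF' _ vF' vY); apply: sub.
    by rewrite (subset_trans (bd0_sub (S :\: X) Y)) // /bag setUA subsetUr.
  have sY := subsetP F'Y s sF'.
  case: (boolP (s \in X)) => sX.
    have F'X : F' \subset X.
      apply: (connected_set_cut cF' _ sF' sX); apply: sub.
      by rewrite /bag setUCA subsetUl.
    by case/negP: (r4 F' famF' F'X); apply: sub; apply: subsetUl.
  have sb : s \in H :|: bag.
    rewrite !in_setU; apply/orP; right; apply/orP; right.
    by apply/bdP; split=> //; left; rewrite inE sX.
  exact: disjointP_in dj sb sF'.
exists (F :: r), (H :|: bag); split.
- by move=> F'; rewrite inE => /orP[/eqP->|/r1].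
- rewrite /= r2 andbT; apply/allP=> F' F'r; exact: r5 HF F'r.
- apply: leq_trans (leq_card_setU _ _) _; rewrite /= mulSn addnC.
  apply: leq_add r3; apply: leq_trans (leq_card_setU _ _) _.
  by apply: leq_trans (leq_add (sweep_bd swX) bdXY) _; rewrite addnS mul2n addnn.
- move=> F' famF' F'Y; apply/negP=> /(disjbag F' famF') dj.
  have [_ [s sF' _]] := famP F' famF'.
  exact: disjointP_in dj (subsetP F'Y s sF') sF'.
- move=> F' F'' famF' dj; rewrite inE => /orP[/eqP->|F''r].
    rewrite disjoint_sym; apply: disjointWl (disjbag F' famF' dj).
    exact: FY.
  apply: r5 F''r => //; apply: disjointWl dj; exact: subsetUl.
Qed.

Lemma sweep_hitting (fam : {set G} -> Prop) m :
    (forall F, fam F -> connected_set F /\ exists2 s, s \in F & s \in S) ->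
    sweep S k setT ->
    ~ (exists f : nat -> {set G}, (forall i, i <= m -> fam (f i)) /\
         forall i j, i < j -> j <= m -> [disjoint f i & f j]) ->
  exists2 H : {set G}, #|H| <= m * (2 * k).+1 &
    forall F, fam F -> exists2 v, v \in F & v \in H.
Proof.
move=> famP sw nodisj.
have [r [H [r1 r2 r3 r4 _]]] := sweep_hitting_aux famP sw.
exists H => [|F famF]; last first.
  have := r4 F famF (subsetT _); rewrite -setI_eq0 => /set0Pn[v /setIP[vH vF]].
  by exists v.
apply: leq_trans r3 _; rewrite leq_mul2r; apply/orP; right.
rewrite leqNgt; apply/negP=> ltm; case: nodisj; exists (nth set0 r); split.
  by move=> i im; apply/r1/mem_nth; apply: leq_ltn_trans im ltm.
move=> i j ij jm; have jr := leq_ltn_trans jm ltm.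
by move/(pairwiseP set0): r2; apply => //; apply: ltn_trans jr.
Qed.
End Hitting.

(** * Fat trees: models of complete d-ary trees *)

Section FatTree.
Variables (G : sgraph) (S : {set G}) (d : nat).

(* A model of the complete d-ary tree of depth j, all of whose branch sets meet
   S, inside U and with Q as the branch set of the root. *)
Fixpoint fat_tree (j : nat) (Q U : {set G}) : Prop :=
  [/\ connected_set Q, connected_set U, exists2 s, s \in Q & s \in S, Q \subset U
    & if j is j'.+1 then
        exists q u : nat -> {set G},
        [/\ forall i, i < d -> fat_tree j' (q i) (u i),
            forall i, i < d -> u i \subset U :\: Q,
            forall i i', i < d -> i' < d -> i != i' -> [disjoint u i & u i'] &
            forall i, i < d -> exists x y, [/\ x \in Q, y \in q i & adj x y]]
      else True].

Lemma fat_treeP j Q U : fat_tree j Q U ->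
  [/\ connected_set Q, connected_set U, exists2 s, s \in Q & s \in S & Q \subset U].
Proof. by case: j => [|j] []. Qed.

Variables (T : sgraph) (c : T) (p : T -> T) (l : T -> nat).
Hypotheses (rT : rooted_tree c p l) (lc : l c = 0).
Hypothesis children : forall v, #|[set w | (w != c) && (p w == v)]| <= d.

Lemma child_index : exists idx : T -> nat,
  (forall w, w != c -> idx w < d) /\
  (forall w w', w != c -> w' != c -> p w = p w' -> idx w = idx w' -> w = w').
Proof.
pose ch v := enum [set w | (w != c) && (p w == v)].
have mem w : w != c -> w \in ch (p w) by move=> wc; rewrite mem_enum inE wc eqxx.
exists (fun w => index w (ch (p w))); split=> [w wc|w w' wc w'c pw eqi].
  apply: leq_trans (children (p w)); rewrite cardE index_mem; exact: mem.
rewrite -(nth_index c (mem w wc)) eqi pw nth_index //; exact: mem.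
Qed.

(** The state once levels up to [j] are embedded: [q] gives the branch sets, and [u v] is the
    territory reserved for what hangs below a vertex [v] of level [j]. *)
Definition fat_tree_levels (h j : nat) (q u : T -> {set G}) : Prop :=
  [/\ forall v, l v <= j -> connected_set (q v) /\ exists2 s, s \in q v & s \in S,
      forall v, l v = j -> fat_tree (h - j) (q v) (u v),
      forall v w, l v <= j -> l w <= j -> v != w -> [disjoint q v & q w],
      forall v w, l v = j -> l w <= j -> v != w ->
        [disjoint u v & q w] /\ (l w = j -> [disjoint u v & u w]) &
      forall v, v != c -> l v <= j ->
        exists x y, [/\ x \in q (p v), y \in q v & adj x y]].

Lemma fat_tree_level_step h j q u :
    j < h -> fat_tree_levels h j q u ->
  exists q' u', fat_tree_levels h j.+1 q' u'.
Proof.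
move=> jh [I1 I2 I3 I4 I5]; have [idx [idxd idx_inj]] := child_index.
have /choice[F FP] : forall v, exists r : (nat -> {set G}) * (nat -> {set G}),
    l v = j ->
    [/\ forall i, i < d -> fat_tree (h - j.+1) (r.1 i) (r.2 i),
        forall i, i < d -> r.2 i \subset u v :\: q v,
        forall i i', i < d -> i' < d -> i != i' -> [disjoint r.2 i & r.2 i'] &
        forall i, i < d -> exists x y, [/\ x \in q v, y \in r.1 i & adj x y]].
  move=> v; case: (eqVneq (l v) j) => [vj|/eqP vj]; last first.
    by exists (fun _ => set0, fun _ => set0).
  have := I2 v vj; rewrite -[h - j]prednK ?subn_gt0 // -subnS /=.
  by case=> _ _ _ _ [q0 [u0 H]]; exists (q0, u0).
have lvl v : l v = j.+1 -> v != c /\ l (p v) = j.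
  move=> vj; have vc : v != c by apply/eqP=> E; rewrite E lc in vj.
  by split=> //; move: vj; rewrite (rT.1 v vc) => -[].
pose q' v := if l v == j.+1 then (F (p v)).1 (idx v) else q v.
pose u' v := if l v == j.+1 then (F (p v)).2 (idx v) else u v.
have q'E v : l v <= j -> q' v = q v.
  by move=> vj; rewrite /q' ltn_eqF.
have ft v : l v = j.+1 -> fat_tree (h - j.+1) (q' v) (u' v).
  move=> vj; have [vc pj] := lvl v vj; rewrite /q' /u' vj eqxx.
  by have [H _ _ _] := FP _ pj; apply: H; apply: idxd.
have u'sub v : l v = j.+1 -> u' v \subset u (p v) :\: q (p v).
  move=> vj; have [vc pj] := lvl v vj; rewrite /u' vj eqxx.
  by have [_ H _ _] := FP _ pj; apply: H; apply: idxd.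
have leE v : l v <= j.+1 -> l v <= j \/ l v = j.+1.
  by rewrite leq_eqVlt => /orP[/eqP->|]; [right|left].
have u'q v w : l v = j.+1 -> l w <= j -> [disjoint u' v & q w].
  move=> vj wj; have [vc pj] := lvl v vj; apply: disjointWl (u'sub v vj) _.
  have [<-|ne] := eqVneq (p v) w.
    by rewrite -setI_eq0 setIC setIDA setDIl setDv set0I.
  by apply: disjointWl (subsetDl _ _) _; have [] := I4 _ _ pj wj ne.
have u'u' v w : l v = j.+1 -> l w = j.+1 -> v != w -> [disjoint u' v & u' w].
  move=> vj wj vw; have [vc pvj] := lvl v vj; have [wc pwj] := lvl w wj.
  have [pE|ne] := eqVneq (p v) (p w).
    rewrite /u' vj wj eqxx pE; have [_ _ H _] := FP _ pwj; apply: H.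
    - exact: idxd.
    - exact: idxd.
    - by apply: contra_neq vw; apply: idx_inj.
  apply: disjointWl (subset_trans (u'sub v vj) (subsetDl _ _)) _.
  apply: disjointWr (subset_trans (u'sub w wj) (subsetDl _ _)) _.
  by have [_ H] := I4 _ _ pvj (eq_leq pwj) ne; apply: H.
have q'u' v : l v = j.+1 -> q' v \subset u' v by move=> /ft/fat_treeP[].
exists q', u'; split.
- move=> v /leE[vj|/ft/fat_treeP[? _ ? _]] //.
  by rewrite q'E //; apply: I1.
- exact: ft.
- move=> v w /leE[vj|vj] /leE[wj|wj] vw.
  + by rewrite !q'E //; apply: I3.
  + rewrite (q'E v) // disjoint_sym.
    by apply: disjointWl (q'u' w wj) _; apply: u'q.
  + by rewrite (q'E w) //; apply: disjointWl (q'u' v vj) _; apply: u'q.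
  + apply: disjointWl (q'u' v vj) _; apply: disjointWr (q'u' w wj) _.
    exact: u'u'.
- move=> v w vj /leE[wj|wj] vw; split.
  + by rewrite (q'E w) //; apply: u'q.
  + by move=> E; rewrite E ltnn in wj.
  + by apply: disjointWr (q'u' w wj) _; apply: u'u'.
  + by move=> _; apply: u'u'.
- move=> v vc /leE[vj|vj].
    rewrite !q'E //; first exact: I5.
    by rewrite -ltnS -(rT.1 v vc); apply: leqW.
  have [_ pj] := lvl v vj; rewrite (q'E (p v)) ?pj // /q' vj eqxx.
  by have [_ _ _ H] := FP _ pj; apply: H; apply: idxd.
Qed.

(** The rooted tree embeds level by level into the complete d-ary tree, siblings going to distinct
    children by [child_index]. *)
Lemma fat_tree_model h Q U :
    (forall v, l v <= h) -> fat_tree h Q U ->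
  exists B : T -> {set G}, rooted_model S B.
Proof.
move=> lh ft.
have l0 v : l v = 0 -> v = c.
  by move=> v0; apply: contraTeq isT => /(rT.1 v); rewrite v0.
have H j : j <= h -> exists q u, fat_tree_levels h j q u.
  elim: j => [|j IH] jh; last first.
    by have [q [u I]] := IH (ltnW jh); apply: fat_tree_level_step I.
  exists (fun _ => Q), (fun _ => U).
  have [cQ _ sQ _] := fat_treeP ft.
  split=> [v _|v _|v w|v w|v vc]; rewrite ?subn0 ?leqn0 //.
  - by move=> /eqP/l0-> /eqP/l0->; rewrite eqxx.
  - by move=> /l0-> /eqP/l0->; rewrite eqxx.
  - by move=> /eqP/l0 E; rewrite E eqxx in vc.
have [q [u [I1 _ I3 _ I5]]] := H h (leqnn h).
exists q; split=> [v|v|v w|v w].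
- by case: (I1 v (lh v)).
- by case: (I1 v (lh v)).
- exact: I3.
- case/rT.2=> -[vc <-]; last exact: I5.
  by have [x [y [xq yq xy]]] := I5 v vc (lh v); exists y, x; rewrite adj_sym.
Qed.
End FatTree.

(** * Rooting a tree at its centre *)

Section Rooting.
Variable T : sgraph.
Hypothesis treeT : is_tree T.

Lemma walkP k (x y : T) :
  reflect (exists q, [/\ size q = k, path (@adj T) x q & last x q = y]) (walk k x y).
Proof.
apply: (iffP existsP) => [[q /andP[pq /eqP lq]]|[q [sq pq lq]]].
  by exists q; rewrite size_tuple.
by exists (Tuple (introT eqP sq)); rewrite /= pq lq eqxx.
Qed.

Lemma tree_walk (x y : T) : exists2 k, k < #|T| & walk k x y.
Proof.
have [_ cT _] := treeT.
have /connectP[q] := cT x y (in_setT _) (in_setT _).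
have -> : path [rel u v | [&& u \in [set: T], v \in [set: T] & adj u v]] x q
    = path (@adj T) x q by apply: eq_path => u v /=; rewrite !inE.
case/shortenP=> q' pq' uq' _ yE; exists (size q').
  by have := max_card [in x :: q']; rewrite (card_uniqP uq').
by apply/walkP; exists q'.
Qed.

Lemma dist_walk (x y : T) : walk (dist x y) x y.
Proof.
have [k kT wk] := tree_walk x y.
have hs : has (fun k => walk k x y) (iota 0 #|T|).
  by apply/hasP; exists k; rewrite // mem_iota.
have := nth_find 0 hs; rewrite nth_iota // -[X in _ < X](size_iota 0).
by rewrite -has_find.
Qed.

Lemma dist_le (x y : T) k : walk k x y -> dist x y <= k.
Proof.
move=> wk; rewrite leqNgt; apply/negP=> lt.
have := before_find 0 lt; rewrite nth_iota ?add0n ?wk //.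
by apply: leq_trans lt _; rewrite -[X in _ <= X](size_iota 0) find_size.
Qed.

Lemma dist_adj (x u v : T) : adj u v -> dist x v <= (dist x u).+1.
Proof.
move=> uv; have /walkP[q [sq pq lq]] := dist_walk x u.
apply/dist_le/walkP; exists (rcons q v).
by rewrite size_rcons sq rcons_path last_rcons pq lq uv.
Qed.

Lemma dist_parent (x v : T) : v != x -> exists2 u, adj v u & dist x v = (dist x u).+1.
Proof.
move=> vx; have /walkP[q [sq pq lq]] := dist_walk x v.
case/lastP: q sq pq lq => [|q w] sq; first by move=> _ /= E; rewrite E eqxx in vx.
rewrite rcons_path last_rcons => /andP[pq uw] wE; rewrite wE in uw.
exists (last x q); first by rewrite adj_sym.
apply/eqP; rewrite eqn_leq dist_adj //= -sq size_rcons ltnS.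
by apply/dist_le/walkP; exists q.
Qed.

Lemma dist_self (x : T) : dist x x = 0.
Proof. by apply/eqP; rewrite -leqn0; apply/dist_le/walkP; exists [::]. Qed.

Lemma radius_center : exists c : T, forall v, dist c v <= radius T.
Proof.
have [/card_gt0P[x _] _ _] := treeT.
suff [c ec] : exists c : T, eccentricity c <= radius T.
  by exists c => v; apply: leq_trans ec; apply: leq_bigmax.
rewrite /radius; elim/big_rec: _ => [|c m _ [c' mc']].
  exists x; apply/bigmax_leqP=> v _.
  by rewrite -[X in _ <= X](size_iota 0) find_size.
by rewrite /minn; case: ifP => _; [exists c | exists c'].
Qed.

(** A walk avoiding this arc would close a cycle with it. Removing one direction is enough: a path
    without repetitions from [u] never returns to [u]. *)
Lemma tree_bridge (u v : T) : adj u v ->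
  ~ connect [rel a b | adj a b && ~~ ((a == u) && (b == v))] u v.
Proof.
move=> uv /connectP[q /shortenP[q' pq' uq' _] vE].
have [_ _ /(_ (u :: q')) ac] := treeT.
have pa : path (@adj T) u q' by apply: sub_path pq' => a b /andP[].
apply: ac; last first.
  by rewrite /ucycle uq' andbT /= rcons_path pa -vE adj_sym uv.
case: q' pq' vE {uq' pa} => [|w [|w' q']] //=.
  by move=> _ E; rewrite E adj_irr in uv.
by move=> /andP[/andP[_ H] _] E; rewrite -E !eqxx in H.
Qed.

(** Distances from a centre serve as levels. An edge that does not join a vertex to its parent would
    be bypassed by the parent walks of its two ends, contradicting [tree_bridge]. *)
Lemma tree_rooted : exists (c : T) (p : T -> T) (l : T -> nat),
  [/\ rooted_tree c p l, l c = 0, forall v, l v <= radius T &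
      forall v, #|[set w | (w != c) && (p w == v)]| <= max_degree T].
Proof.
have [c cP] := radius_center.
have /choice[p pP] : forall v, exists u, v != c ->
    adj v u /\ dist c v = (dist c u).+1.
  move=> v; case: (eqVneq v c) => [_|vc]; first by exists v.
  by have [u vu E] := dist_parent vc; exists u.
exists c, p, (dist c); split=> //; [|exact: dist_self|]; last first.
  move=> v; apply: leq_trans (leq_bigmax v); apply: subset_leq_card.
  apply/subsetP=> w; rewrite !inE => /andP[wc /eqP<-].
  by rewrite adj_sym; case: (pP w wc).
split=> [v vc|]; first by case: (pP v vc).
have key u v : adj u v -> dist c v <= dist c u -> u != c /\ p u = v.
  move=> uv le; have une : u != v by apply: contraTneq uv => ->; rewrite adj_irr.
  have uc : u != c.
    apply/eqP=> E; move: le; rewrite E dist_self leqn0 => /eqP v0.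
    case: (eqVneq v c) => [vc|vc]; first by rewrite E vc eqxx in une.
    by have [_] := pP v vc; rewrite v0.
  split=> //; apply/eqP; apply: contraT => puv.
  case: (tree_bridge uv).
  pose e := [rel a b : T | adj a b && ~~ (((a == u) && (b == v)) || ((a == v) && (b == u)))].
  have esym : symmetric e.
    by move=> a b /=; rewrite adj_sym; case: (a == u); case: (a == v);
      case: (b == u); case: (b == v).
  (* Past its start, the parent walk is strictly closer to [c] than [u] is, so it never visits [u]
     and cannot use the edge. *)
  have toc n w : dist c w <= n -> w != u -> dist c w <= dist c u -> connect e w c.
    elim: n w => [|n IH] w wn wu wle.
      case: (eqVneq w c) => [->|wc]; first exact: connect0.
      by have [_ E] := pP w wc; rewrite E in wn.
    case: (eqVneq w c) => [->|wc]; first exact: connect0.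
    have [wp E] := pP w wc.
    have lt : dist c (p w) < dist c u by rewrite -E.
    have pu : p w != u by apply: contraTneq lt => ->; rewrite ltnn.
    apply: (connect_trans (y := p w)); last by apply: IH (ltnW lt) => //; rewrite -ltnS -E.
    by apply: connect1; rewrite /= wp (negPf wu) (negPf pu) andbF.
  have [up E] := pP u uc.
  have cu : connect e u v.
    apply: (connect_trans (y := p u)).
      by apply: connect1; rewrite /= up (negPf puv) (negPf une) andbF.
    apply: (connect_trans (y := c)).
      apply: (toc (dist c (p u))) => //; last by rewrite E.
      by apply/eqP=> pu; move/eqP: E; rewrite pu eqn_leq ltnn andbF.
    rewrite (sym_connect_sym esym); apply: (toc (dist c v)) => //.
    by rewrite eq_sym.
  apply: connect_sub cu => a b /andP[ab] /norP[H _]; apply: connect1.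
  by rewrite /= ab.
move=> u v uv; case: (leqP (dist c v) (dist c u)) => le.
  by left; apply: key.
by right; apply: key (ltnW le); rewrite // adj_sym.
Qed.
End Rooting.

(** * Partial decompositions *)

Lemma connected_set_nbrs (G : sgraph) (A X : {set G}) :
    A != set0 -> connected_set A ->
    (forall x, x \in X -> exists2 a, a \in A & adj a x) ->
  connected_set (A :|: X).
Proof.
move=> /set0Pn[a0 a0A] cA nX; apply: connected_setI => P z zAX zP cl.
have [a aA aP] : exists2 a, a \in A & a \in P.
  case/setUP: zAX => [zA|zX]; first by exists z.
  have [a aA az] := nX z zX; exists a => //.
  by apply: (cl z a) => //; rewrite ?inE ?aA ?zX ?orbT // adj_sym.
have AP : A \subset P.
  by apply: (connected_set_sub cA aA aP) => u v uA vA; apply: cl;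
     rewrite inE ?uA ?vA.
rewrite subUset AP; apply/subsetP=> x xX; have [b bA bx] := nX x xX.
by apply: (cl b x) => //; rewrite ?inE ?bA ?xX ?orbT // (subsetP AP).
Qed.

Definition attached (G : sgraph) (U W : {set G}) : Prop :=
  forall u v, u \in U -> v \notin U -> adj u v -> v \in W.

Section PartialDecomposition.
Variables (G : sgraph) (S : {set G}) (b c : nat).
Implicit Types (L B : {set {set G}}) (U P D : {set G}).

(* [partial_dec L B U]: the vertices of U outside the leaves in L can be split
   into parts of size at most c, and arranged in a tree decomposition whose bags
   have at most b parts each and whose root bag is B.  Every leaf is connected,
   avoids S, and its neighbours lie in the parts of a single bag. *)
Inductive partial_dec : {set {set G}} -> {set {set G}} -> {set G} -> Prop :=
| partial_dec0 B : partial_dec set0 B set0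
| partial_dec_leaf B D : D != set0 -> connected_set D -> [disjoint D & S] ->
    attached D (cover B) -> partial_dec [set D] B D
| partial_decU L1 L2 B U1 U2 : [disjoint U1 & U2] ->
    (forall u v, u \in U1 -> v \in U2 -> ~~ adj u v) ->
    partial_dec L1 B U1 -> partial_dec L2 B U2 ->
    partial_dec (L1 :|: L2) B (U1 :|: U2)
| partial_dec_part L B B' P U : B' \subset B -> P \subset U -> #|P| <= c ->
    #|B'| < b -> attached U (cover B') ->
    partial_dec L (P |: B') (U :\: P) -> partial_dec L B U.

Lemma cover_subset B B' : B \subset B' -> cover B \subset cover B'.
Proof.
move=> sB; apply/subsetP=> v /bigcupP[P PB vP]; apply/bigcupP; exists P => //.
exact: (subsetP sB).
Qed.

Lemma coverU1 P B : cover (P |: B) = P :|: cover B.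
Proof.
apply/setP=> v; apply/bigcupP/setUP=> [[Q /setU1P[->|QB] vQ]|[vP|/bigcupP[Q QB vQ]]].
- by left.
- by right; apply/bigcupP; exists Q.
- by exists P; rewrite ?setU11.
- by exists Q; rewrite // inE QB orbT.
Qed.

Lemma partial_dec_weaken L B B' U :
  B \subset B' -> partial_dec L B U -> partial_dec L B' U.
Proof.
move=> sB H; elim: H B' sB => {L B U}.
- by move=> B B' _; apply: partial_dec0.
- move=> B D D0 cD dD aD B' sB; apply: partial_dec_leaf => //.
  move=> u v uD vD uv; apply: (subsetP (cover_subset sB)); exact: aD uv.
- move=> L1 L2 B U1 U2 dU nU _ IH1 _ IH2 B' sB.
  by apply: partial_decU => //; [apply: IH1|apply: IH2].
- move=> L B B1 P U sB1 PU cP cB aU pd _ B' sB.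
  by apply: (partial_dec_part (subset_trans sB1 sB) PU).
Qed.

Lemma partial_dec_leaves L B U : partial_dec L B U ->
  [/\ forall D, D \in L ->
        [/\ D \subset U, D != set0, connected_set D & [disjoint D & S]],
      {in L &, forall D D', D != D' -> [disjoint D & D']} &
      {in L &, forall D D', D != D' ->
         forall u v, u \in D -> v \in D' -> ~~ adj u v}].
Proof.
elim=> {L B U} [B|B D D0 cD dD aD|L1 L2 B U1 U2 dU nU _ [I1 I2 I3] _ [J1 J2 J3]
  |L B B' P U _ PU _ _ _ _ [I1 I2 I3]].
- by split=> [D|D D'|D D']; rewrite inE.
- split=> [D' /set1P->|D' D'' /set1P-> /set1P->|D' D'' /set1P-> /set1P->] //;
    by rewrite eqxx.
- have cross D D' : D \in L1 -> D' \in L2 ->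
      [disjoint D & D'] /\ forall u v, u \in D -> v \in D' -> ~~ adj u v.
    move=> /I1[sD _ _ _] /J1[sD' _ _ _]; split.
      exact: disjointWl sD (disjointWr sD' dU).
    by move=> u v uD vD'; apply: nU; [apply: (subsetP sD)|apply: (subsetP sD')].
  split=> [D /setUP[/I1[sD ? ? ?]|/J1[sD ? ? ?]]|D D' DL D'L ne|D D' DL D'L ne u v uD vD'].
  + by split=> //; apply: subset_trans sD (subsetUl _ _).
  + by split=> //; apply: subset_trans sD (subsetUr _ _).
  + case/setUP: DL => DL; case/setUP: D'L => D'L.
    * exact: I2.
    * by have [] := cross D D' DL D'L.
    * by rewrite disjoint_sym; have [] := cross D' D D'L DL.
    * exact: J2.
  + case/setUP: DL => DL; case/setUP: D'L => D'L.
    * exact: (I3 D D').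
    * by have [_] := cross D D' DL D'L; apply.
    * by rewrite adj_sym; have [_] := cross D' D D'L DL; apply.
    * exact: (J3 D D').
- by split=> // D /I1[sD ? ? ?]; split=> //; apply: subset_trans sD (subsetDl _ _).
Qed.

Variables (k d j : nat).
Hypothesis sw : sweep S k setT.
Hypothesis cE : d * (2 * k).+1 <= c.

(** The statement proved by induction on the depth. The root of the excluded tree is pinned at [r],
    the vertex through which a piece touches the grown root; each unit of depth costs two parts. *)
Definition decomposable j := forall (J : {set G}) r B,
  connected_set J -> r \in J ->
  (forall Q U, fat_tree S d j Q U -> r \in Q -> ~~ (U \subset J)) ->
  #|B| + 2 * j <= b -> attached J (cover B) -> exists L, partial_dec L B J.

(* One of the d + 1 subtrees is merged into the root to make it meet S. *)
Lemma fat_tree_join (R K : {set G}) (f : nat -> {set G}) :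
    R != set0 -> connected_set R -> R \subset K ->
    (forall i, i <= d -> exists Q, [/\ fat_tree S d j Q (f i), f i \subset K :\: R &
       exists x y, [/\ x \in R, y \in Q & adj x y]]) ->
    (forall i i', i < i' -> i' <= d -> [disjoint f i & f i']) ->
  exists Q U, [/\ fat_tree S d j.+1 Q U, R \subset Q & U \subset K].
Proof.
move=> R0 cR RK fP dj.
have /choice[q qP] : forall i, exists Q, i <= d ->
    [/\ fat_tree S d j Q (f i), f i \subset K :\: R &
        exists x y, [/\ x \in R, y \in Q & adj x y]].
  by move=> i; case: (leqP i d) => [/fP[Q]|_]; [exists Q | exists set0].
have [ftd sd [x [y [xR yq xy]]]] := qP d (leqnn d).
have [_ cfd [s sq sS] qfd] := fat_treeP ftd.
have cQ : connected_set (R :|: f d).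
  by apply: (connected_setU cR cfd xR (subsetP qfd y yq)); rewrite xy orbT.
exists (R :|: f d), ((R :|: f d) :|: \bigcup_(i < d) f i); split.
- split=> //.
  + apply: connected_set_bigcup => //.
    * by apply/set0Pn; exists x; rewrite inE xR.
    * by move=> i; have [/fat_treeP[]] := qP i (ltnW (ltn_ord i)).
    * move=> i; have [/fat_treeP[_ _ _ qf] _ [x' [y' [x'R y'q xy']]]] :=
        qP i (ltnW (ltn_ord i)).
      by exists x', y'; rewrite inE x'R (subsetP qf).
  + by exists s; rewrite // inE (subsetP qfd) ?orbT.
  + exact: subsetUl.
  + exists q, f; split.
    * by move=> i /ltnW/qP[].
    * move=> i id; have [_ sf _] := qP i (ltnW id).
      apply/subsetP=> v vf; have /setDP[vK vR] := subsetP sf v vf.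
      rewrite in_setD !in_setU (negPf vR) /=; apply/andP; split.
        by apply/negP=> vd; case: (disjointP_in (dj i d id (leqnn d)) vf vd).
      by apply/orP; right; apply/bigcupP; exists (Ordinal id).
    * move=> i i' id i'd; rewrite neq_ltn => /orP[ii'|ii'].
        by apply: dj => //; apply: ltnW.
      by rewrite disjoint_sym; apply: dj => //; apply: ltnW.
    * move=> i id; have [_ _ [x' [y' [x'R y'q xy']]]] := qP i (ltnW id).
      by exists x', y'; rewrite inE x'R.
- exact: subsetUl.
- rewrite !subUset RK (subset_trans sd (subsetDl _ _)) /=.
  apply/bigcupsP=> i _; have [_ sf _] := qP i (ltnW (ltn_ord i)).
  exact: subset_trans sf (subsetDl _ _).
Qed.

(** [R] is the grown root and [X] contains its frontier towards the rest of [K]. If [d + 1] disjoint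
    trees of depth [j] touched [R], [fat_tree_join] would build the excluded tree; so few vertices
    hit them all. The root then grows up to these vertices, and the rest follows by induction. *)
Lemma partial_dec_chain : decomposable j ->
  forall (K R X : {set G}) B,
    connected_set K -> R != set0 -> connected_set R -> R \subset K ->
    (forall x y, x \in R -> y \in K -> y \notin R -> adj x y -> x \in X) ->
    (forall Q U, fat_tree S d j.+1 Q U -> R \subset Q -> ~~ (U \subset K)) ->
    #|B| + 2 * j.+1 <= b -> attached K (cover B) ->
  exists L, partial_dec L (X |: B) (K :\: R).
Proof.
move=> decj K R X B cK; have [n] := ubnP #|K :\: R|.
elim: n R X => // n IH R X; rewrite ltnS => len R0 cR RK frontier noft leB aK.
have [KR|[z /setDP[zK zR]]] := set_0Vmem (K :\: R).
  by rewrite KR; exists set0; apply: partial_dec0.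
have /set0Pn[r rR] := R0.
pose fam (U : {set G}) := exists Q, [/\ fat_tree S d j Q U, U \subset K :\: R &
       exists x y, [/\ x \in R, y \in Q & adj x y]].
have [U [Q [/fat_treeP[_ cU [s sQ sS] QU] _ _]]||H leH hitH] :=
    @sweep_hitting G S k fam d _ sw.
- by split=> //; exists s => //; apply: (subsetP QU).
- case=> f [fP dj]; have [Q [U [ft RQ UK]]] := fat_tree_join R0 cR RK fP dj.
  by have := noft Q U ft RQ; rewrite UK.
pose W := H :&: (K :\: R).
have rKW : r \in K :\: W by rewrite !inE rR (subsetP RK) // andbF.
pose C := component (K :\: W) r.
have sC : C \subset K :\: W by apply: component_sub.
have RC : R \subset C.
  apply: component_sup => //; apply/subsetP=> x xR.
  by rewrite !inE xR (subsetP RK) // andbF.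
have cC : connected_set C by apply: component_connected.
have CK : C \subset K := subset_trans sC (subsetDl _ _).
(* Only the hitting vertices next to [C] form the new part; the others stay in the remainder. *)
pose X1 := [set x in W | [exists u, (u \in C) && adj u x]].
have X1P x : x \in X1 -> x \in W /\ exists2 u, u \in C & adj u x.
  by rewrite inE => /andP[xW /existsP[u /andP[uC ux]]]; split=> //; exists u.
have CX u v : u \in C -> v \in K -> v \notin C -> adj u v -> v \in X1.
  move=> uC vK vC uv; rewrite inE; apply/andP; split; last first.
    by apply/existsP; exists u; rewrite uC.
  apply: contraR vC => vW; apply: (component_closed rKW uC _ uv).
  by rewrite inE vK vW.
have X1C x : x \in X1 -> x \notin C.
  by move=> /X1P[xW _]; apply/negP=> /(subsetP sC); rewrite inE xW.
have X1KR : X1 \subset K :\: R.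
  by apply/subsetP=> x /X1P[/setIP[]].
have cX1 : #|X1| <= c.
  apply: leq_trans cE; apply: leq_trans leH; apply: subset_leq_card.
  by apply/subsetP=> x /X1P[/setIP[]].
have leXB : #|X |: B| <= #|B|.+1 by rewrite cardsU1; case: (_ \notin _).
(* A component of [C :\: R] contains no hitting vertex, so no tree of depth [j] in it has a root
   touching [R]: the induction on depth applies, with [X] and [X1] as the two extra parts. *)
have [L1 pd1] : exists L, partial_dec L (X1 |: (X |: B)) (C :\: R).
  apply: (@set_components_ind G (fun U => exists L,
            partial_dec L (X1 |: (X |: B)) U)).
  - by exists set0; apply: partial_dec0.
  - move=> U1 U2 _ _ dU nU [L1 pd1] [L2 pd2]; exists (L1 :|: L2).
    exact: partial_decU.
  move=> J sJ J0 cJ clJ; have /set0Pn[a aJ] := J0.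
  have [x [y [xJ yR xy]]] : exists x y, [/\ x \in J, y \in R & adj x y].
    apply: contrapT => no.
    have /subsetP/(_ r) : C \subset J.
      apply: (connected_set_sub cC _ aJ); first by have /setDP[] := subsetP sJ a aJ.
      move=> u v uC vC uJ uv; apply: (clJ u) => //; rewrite inE vC andbT.
      by apply/negP=> vR; apply: no; exists u, v.
    by rewrite (subsetP RC r rR) => /(_ isT) /(subsetP sJ) /setDP[_]; rewrite rR.
  apply: (decj J x) => //.
  - move=> Q U ft xQ; apply/negP=> UJ.
    have UKR : U \subset K :\: R.
      by apply: subset_trans UJ (subset_trans sJ _); apply: setSD.
    have [|v vU vH] := hitH U.
      by exists Q; split=> //; exists y, x; rewrite adj_sym.
    have vW : v \in W by rewrite inE vH (subsetP UKR).
    have /setDP[vC _] := subsetP sJ v (subsetP UJ v vU).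
    by have := subsetP sC v vC; rewrite inE vW.
  - apply: leq_trans leB; rewrite mulnS addnA leq_add2r addn2 cardsU1.
    by case: (_ \notin _); rewrite ?add1n ?add0n // ltnW.
  - move=> u v uJ vJ uv; have /setDP[uC uR] := subsetP sJ u uJ.
    rewrite !coverU1 !in_setU.
    case: (boolP (v \in K)) => vK; last first.
      by rewrite (aK u v) ?orbT // (subsetP CK).
    case: (boolP (v \in C)) => vC; last by rewrite (CX u v).
    case: (boolP (v \in R)) => vR.
      by rewrite (frontier v u) ?orbT ?(subsetP CK) // adj_sym.
    by case/negP: vJ; apply: (clJ u) => //; rewrite inE vR.
(* The new root [C :|: X1] has its frontier in [X1], so [X] leaves the bag and the chain does not
   widen. *)
have [L2 pd2] : exists L, partial_dec L (X1 |: B) (K :\: (C :|: X1)).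
  have RCX : R \subset C :|: X1 := subset_trans RC (subsetUl _ _).
  apply: IH => //.
  - apply: leq_trans len; apply: proper_card; apply/properP; split.
      exact: setDS.
    (* A neighbour of [R] in the rest of [K] falls into [C] or [X1], so the remainder shrinks. *)
    have [x [y [xR yK yR xy]]] : exists x y,
        [/\ x \in R, y \in K, y \notin R & adj x y].
      apply: contrapT => no; case/negP: zR.
      apply: (subsetP (connected_set_sub cK (subsetP RK r rR) rR _)) zK.
      move=> u v uK vK uR uv; apply: contraT => vR.
      by case: no; exists u, v.
    exists y; first by rewrite inE yR.
    rewrite in_setD negb_and negbK in_setU; case: (boolP (y \in C)) => //= yC.
    by have xC := subsetP RC x xR; rewrite (CX x y).
  - by apply/set0Pn; exists r; rewrite inE (subsetP RC).
  - apply: connected_set_nbrs => //; last by move=> x /X1P[].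
    by apply/set0Pn; exists r; rewrite (subsetP RC).
  - by rewrite subUset CK (subset_trans X1KR (subsetDl _ _)).
  - move=> x y /setUP[xC|//] yK; rewrite in_setU negb_or => /andP[yC yX] xy.
    by case/negP: yX; apply: CX xy.
  - by move=> Q U ft RQ; apply: noft ft _; apply: subset_trans RQ.
exists (L1 :|: L2).
apply: (@partial_dec_part _ _ (X |: B) X1) => //.
- apply: leq_ltn_trans leXB _; apply: leq_trans leB.
  by rewrite mulnS addnA addn2 leq_addr.
- move=> u v /setDP[uK uR] vKR uv; rewrite coverU1 in_setU.
  case: (boolP (v \in K)) => vK; last by rewrite (aK u v) ?orbT.
  rewrite (frontier v u) // 1?adj_sym //.
  by move: vKR; rewrite inE vK andbT negbK.
have -> : (K :\: R) :\: X1 = (C :\: R) :|: (K :\: (C :|: X1)).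
  apply/setP=> v; rewrite !in_setD in_setU !in_setD in_setU.
  case: (boolP (v \in C)) => vC /=.
    by rewrite (subsetP CK) // andbT orbF; case: (boolP (v \in X1)) => // /X1C/negP[].
  have -> : v \notin R by apply: contra vC; apply: (subsetP RC).
  by rewrite orFb.
apply: partial_decU => //.
- apply/pred0P=> v /=; apply/negP=> /andP[/setDP[vC _] /setDP[_]].
  by rewrite in_setU vC.
- move=> u v /setDP[uC _] /setDP[vK]; rewrite in_setU negb_or => /andP[vC vX].
  by apply: contra vX; apply: CX.
- apply: partial_dec_weaken pd2; apply: setUS; exact: subsetUr.
Qed.

End PartialDecomposition.

(** At depth 0 a connected set meeting [S] is itself a fat tree, so [J] avoids [S] and is a leaf. At
    larger depth the chain starts from the root and part [[set r]], which fits because [c] is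
    positive. *)
Lemma decomposable_all (G : sgraph) (S : {set G}) b c k d j :
    sweep S k setT -> d * (2 * k).+1 <= c -> 0 < c ->
  decomposable S b c d j.
Proof.
move=> sw cE c0; elim: j => [|j IH] J r B cJ rJ noft leB aJ.
  exists [set J]; apply: partial_dec_leaf => //; first by apply/set0Pn; exists r.
  apply/pred0P=> s /=; apply/negP=> /andP[sJ sS].
  have := noft J J; rewrite subxx => H; suff: false by [].
  by apply: H => //; split=> //; exists s.
have [||||||||L pd] := @partial_dec_chain G S b c k d j sw cE IH J [set r] [set r] B.
- by [].
- by apply/set0Pn; exists r; rewrite set11.
- exact: connected_set1.
- by rewrite sub1set.
- by [].
- by move=> Q U ft; rewrite sub1set; apply: noft.
- by [].
- by [].
exists L; apply: (@partial_dec_part _ _ _ _ _ B B [set r]) => //.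
- by rewrite sub1set.
- by rewrite cards1.
- by apply: leq_trans leB; rewrite mulnS addnA addn2; apply: leq_trans (leq_addr _ _).
Qed.

Lemma partial_dec_exists (G : sgraph) (S C : {set G}) c k d h :
    sweep S k setT -> d * (2 * k).+1 <= c -> 0 < c ->
    (forall Q U, ~ fat_tree S d h Q U) -> attached C set0 ->
  exists L, partial_dec S (2 * h) c L set0 C.
Proof.
move=> sw cE c0 noft aC.
apply: (@set_components_ind G (fun U => exists L, partial_dec S (2 * h) c L set0 U)).
- by exists set0; apply: partial_dec0.
- move=> U1 U2 _ _ dU nU [L1 pd1] [L2 pd2]; exists (L1 :|: L2).
  exact: partial_decU.
move=> J sJ /set0Pn[r rJ] cJ clJ.
apply: (decomposable_all sw cE c0 cJ rJ) => [Q U /noft//||u v uJ vJ uv].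
  by rewrite cards0.
case: (boolP (v \in C)) => vC; first by case/negP: vJ; apply: clJ uv.
by have := aC u v (subsetP sJ u uJ) vC uv; rewrite inE.
Qed.

(** * Decompositions *)

Section Decomposition.
Variables (G : sgraph) (b c : nat).
Implicit Types (B : {set {set G}}) (U P : {set G}).

(** An empty part could recur in unrelated bags, whose nodes would then not form a subtree; hence
    [P != set0]. *)
Inductive dec : {set {set G}} -> {set G} -> Prop :=
| dec0 B : dec B set0
| decU B U1 U2 : [disjoint U1 & U2] ->
    (forall u v, u \in U1 -> v \in U2 -> ~~ adj u v) ->
    dec B U1 -> dec B U2 -> dec B (U1 :|: U2)
| dec_part B B' P U : B' \subset B -> P \subset U -> P != set0 -> #|P| <= c ->
    #|B'| < b -> attached U (cover B') -> dec (P |: B') (U :\: P) -> dec B U.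

Lemma dec_weaken B B' U : B \subset B' -> dec B U -> dec B' U.
Proof.
move=> sB H; elim: H B' sB => {B U} [B|B U1 U2 dU nU _ IH1 _ IH2|B B1 P U]
  => [B' _|B' sB|sB1 PU P0 cP cB aU pd _ B' sB].
- exact: dec0.
- by apply: decU => //; [apply: IH1|apply: IH2].
- exact: (dec_part (subset_trans sB1 sB) PU).
Qed.
End Decomposition.

Section Induced.
Variables (G : sgraph) (C : {set G}).

Definition induced_adj : rel G := [rel u v | [&& u \in C, v \in C & adj u v]].

Lemma induced_adj_sym : symmetric induced_adj.
Proof. by move=> u v; rewrite /induced_adj /= adj_sym andbCA. Qed.

Lemma induced_adj_irr : irreflexive induced_adj.
Proof. by move=> u; rewrite /induced_adj /= adj_irr !andbF. Qed.

(* The vertices outside C are kept, as isolated vertices. *)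
Definition induced : sgraph := SGraph induced_adj_sym induced_adj_irr.

Lemma induced_connected (D : {set G}) :
  @connected_set induced D -> connected_set D.
Proof.
move=> cD; apply: connected_setI => P x xD xP cl.
apply: (@connected_set_sub induced D P x cD xD xP) => u v uD vD uP.
by case/and3P=> _ _ uv; apply: cl uv.
Qed.
End Induced.

(** * Enlarging the leftover pieces and trimming the parts *)

Section Closure.
Variables (G : sgraph) (A C : {set G}) (c : nat).
Hypotheses (cA : connected_set A) (cAC : connected_set (A :|: C)).
Hypotheses (dAC : [disjoint A & C]) (aC : attached C A).
Variable a0 : G.
Hypothesis a0A : a0 \in A.

Definition root_set : {set G} := [set v in C | [exists a in A, adj a v]].
Let K := induced C.
Let V := A :|: C.
Implicit Types (D P U Z : {set G}) (B : {set {set G}}).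

(* D together with everything that D separates from A. *)
Definition closure_of (D : {set G}) : {set G} := V :\: component (V :\: D) a0.

Lemma a0V D : D \subset C -> a0 \in V :\: D.
Proof.
move=> DC; rewrite !inE a0A andbT; apply/negP=> /(subsetP DC).
exact: disjointP_in dAC a0A.
Qed.

Lemma in_V u v : u \in C -> adj u v -> v \in V.
Proof.
by move=> uC uv; rewrite inE; case: (boolP (v \in C)) => vC; rewrite ?orbT ?(aC uC vC uv).
Qed.

Lemma closure_sup D : D \subset C -> D \subset closure_of D.
Proof.
move=> DC; apply/subsetP=> v vD; rewrite inE in_setU (subsetP DC) // orbT andbT.
by apply/negP=> /(subsetP (component_sub (a0V DC))); rewrite inE vD.
Qed.

Lemma closure_sub D : D \subset C -> closure_of D \subset C.
Proof.
move=> DC; apply/subsetP=> v; rewrite inE in_setU => /andP[nv /orP[vA|//]].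
case/negP: nv; apply: (subsetP (component_sup a0A _ cA)) vA.
apply/subsetP=> u uA; rewrite !inE uA andbT; apply/negP=> /(subsetP DC).
exact: disjointP_in dAC uA.
Qed.

Lemma closure_compl D : D \subset C -> V :\: closure_of D = component (V :\: D) a0.
Proof.
move=> DC; apply/setP=> v; rewrite [LHS]inE [v \in closure_of D]inE.
rewrite negb_and negbK; case: (boolP (v \in component _ _)) => [vc|_] /=.
  by have /setDP[-> _] := subsetP (component_sub (a0V DC)) v vc.
by rewrite andNb.
Qed.

(** The outer end lies in the component of [a0], which would absorb [u] if [u] were not in [D]. *)
Lemma closure_edge D u v : D \subset C ->
  u \in closure_of D -> v \notin closure_of D -> adj u v -> u \in D.
Proof.
move=> DC uc vc uv; apply: contraT => uD.
have uC := subsetP (closure_sub DC) u uc.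
have vD : v \in component (V :\: D) a0.
  by rewrite -closure_compl // inE vc (in_V uC).
move: uc; rewrite inE => /andP[/negP[]].
by apply: (component_closed (a0V DC) vD); rewrite ?inE ?uD ?uC ?orbT // adj_sym.
Qed.

Lemma closure_connected D D' : D \subset C -> D' \subset C ->
    connected_set D' -> [disjoint D' & D] ->
  D' \subset closure_of D \/ [disjoint D' & closure_of D].
Proof.
move=> DC D'C cD' dj.
have [ds|/pred0Pn[x /andP[/= xD' xc]]] := boolP [disjoint D' & closure_of D].
  by right.
left; apply: (connected_set_sub cD' xD' xc) => u v uD' vD' uc uv.
apply: contraT => vc; have uD := closure_edge DC uc vc uv.
by case: (disjointP_in dj uD' uD).
Qed.

Lemma closure_mono D D' : D \subset C -> D' \subset C ->
  D \subset closure_of D' -> closure_of D \subset closure_of D'.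
Proof.
move=> DC D'C sD; apply: setDS; apply: component_sup.
- exact: component_refl.
- apply/subsetP=> v vc; have /setDP[vV _] := subsetP (component_sub (a0V D'C)) v vc.
  rewrite inE vV andbT; apply/negP=> /(subsetP sD); rewrite inE.
  by rewrite vc.
- exact: component_connected (a0V D'C).
Qed.

(** Connectivity of [V] would spread [Z] to [a0], which is outside [C]. This rules out sets that no
    edge leaves. *)
Lemma V_closed Z z : z \in Z -> Z \subset C ->
  (forall u v, u \in Z -> v \in V -> adj u v -> v \in Z) -> False.
Proof.
move=> zZ ZC cl; have zV : z \in V by rewrite inE (subsetP ZC) ?orbT.
have a0Z : a0 \in Z.
  apply: (subsetP (connected_set_sub cAC zV zZ _)); last by rewrite inE a0A.
  by move=> u v _ vV uZ; apply: cl.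
exact: disjointP_in dAC a0A (subsetP ZC _ a0Z).
Qed.

Variable L : {set {set G}}.
Hypothesis LC : forall D, D \in L -> D \subset C.
Hypothesis Lconn : forall D, D \in L -> connected_set D.
Hypothesis LS : forall D, D \in L -> [disjoint D & root_set].
Hypothesis Ldisj : {in L &, forall D D', D != D' -> [disjoint D & D']}.
Hypothesis Lnadj : {in L &, forall D D', D != D' ->
  forall u v, u \in D -> v \in D' -> ~~ adj u v}.

Definition maximal_leaf D := (D \in L) &&
  [forall D' in L, (D \subset closure_of D') ==> (D' == D)].

Definition enclosed : {set G} := \bigcup_(D in L) closure_of D.

Lemma maximal_leaf_disjoint D D' : maximal_leaf D -> D' \in L -> D' != D ->
  [disjoint D & closure_of D'].
Proof.
case/andP=> DL /forallP/(_ D') /implyP H D'L ne.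
have dj : [disjoint D & D'] by apply: Ldisj; rewrite // eq_sym.
have [s|//] := closure_connected (LC D'L) (LC DL) (Lconn DL) dj.
by have := H D'L; rewrite s (negPf ne).
Qed.

(** An edge leaving the intersection would start in [D] or in [D'], yet each of these misses the
    closure of the other; so [V_closed] excludes a common vertex. *)
Lemma maximal_closure_disjoint D D' : maximal_leaf D -> maximal_leaf D' -> D != D' ->
  [disjoint closure_of D & closure_of D'].
Proof.
move=> mD mD' ne; have [DL _] := andP mD; have [D'L _] := andP mD'.
apply/pred0P=> x /=; apply/negP=> /andP[xD xD'].
have ne' : D' != D by rewrite eq_sym.
apply: (@V_closed (closure_of D :&: closure_of D') x).
- by rewrite inE xD.
- exact: subset_trans (subsetIl _ _) (closure_sub (LC DL)).
- move=> u v /setIP[uD uD'] vV uv; rewrite inE; apply/andP; split.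
    apply: contraT => vD; have := closure_edge (LC DL) uD vD uv.
    by move=> uDD; case: (disjointP_in (maximal_leaf_disjoint mD D'L ne') uDD uD').
  apply: contraT => vD; have := closure_edge (LC D'L) uD' vD uv.
  by move=> uDD; case: (disjointP_in (maximal_leaf_disjoint mD' DL ne) uDD uD).
Qed.

(** If [v] lay in the closure of another leaf, the edge would have to run from the first leaf itself
    to the second, and distinct leaves are not adjacent. *)
Lemma maximal_closure_edge D u v : maximal_leaf D ->
  u \in closure_of D -> v \notin closure_of D -> adj u v -> v \notin enclosed.
Proof.
move=> mD uD vD uv; have [DL _] := andP mD; apply/negP=> /bigcupP[D' D'L vD'].
have ne : D' != D by apply: contraNneq vD => <-.
have uDD := closure_edge (LC DL) uD vD uv.
have uD' : u \notin closure_of D'.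
  by apply/negP; apply: disjointP_in (maximal_leaf_disjoint mD D'L ne) uDD.
have vu : adj v u by rewrite adj_sym.
have vDD := closure_edge (LC D'L) vD' uD' vu.
by case/negP: (Lnadj D'L DL ne vDD uDD).
Qed.

(** A leaf with the largest closure works. If another leaf enclosed it, the two closures would
    coincide, and an edge leaving them would start in two disjoint leaves at once. *)
Lemma enclosed_maximal v : v \in enclosed ->
  exists2 D, maximal_leaf D & v \in closure_of D.
Proof.
case/bigcupP=> D DL vD.
have PD : (D \in L) && (closure_of D \subset closure_of D) by rewrite DL subxx.
have [M /andP[ML DM] maxM] := @arg_maxnP _ D
  (fun D' => (D' \in L) && (closure_of D \subset closure_of D'))
  (fun D' => #|closure_of D'|) PD.
exists M; last exact: (subsetP DM).
rewrite /maximal_leaf ML; apply/forallP=> D'; apply/implyP=> D'L; apply/implyP=> sM.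
have sMD := closure_mono (LC ML) (LC D'L) sM.
have /eqP E : closure_of M == closure_of D'.
  by rewrite eqEcard sMD; apply: maxM; rewrite D'L (subset_trans DM).
apply: contraT => ne.
case: (@V_closed (closure_of M) v) => //; first exact: (subsetP DM).
  exact: closure_sub (LC ML).
move=> x y xM yV xy; apply: contraT => yM.
have x1 := closure_edge (LC ML) xM yM xy.
rewrite E in xM yM; have x2 := closure_edge (LC D'L) xM yM xy.
by case: (disjointP_in (Ldisj D'L ML ne) x2 x1).
Qed.

Definition reduced_bag (B : {set {set G}}) : {set {set G}} :=
  [set P :\: enclosed | P in B] :\ set0.

(** What a decomposition of [U] with leaves [L'] must place after the enlargement: closures may
    reach beyond [U], and enclosed vertices of [U] may be placed elsewhere. *)
Definition reduced_set (L' : {set {set G}}) (U : {set G}) : {set G} :=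
  (U :\: enclosed) :|: \bigcup_(D in L' | maximal_leaf D) closure_of D.

Lemma reduced_setP (L' : {set {set G}}) (U : {set G}) v :
  reflect ((v \in U /\ v \notin enclosed) \/
           exists D, [/\ D \in L', maximal_leaf D & v \in closure_of D])
          (v \in reduced_set L' U).
Proof.
apply: (iffP setUP) => -[H|H].
- by left; case/setDP: H.
- by right; case/bigcupP: H => D /andP[DL mD] vD; exists D.
- by left; apply/setDP.
- by right; case: H => D [DL mD vD]; apply/bigcupP; exists D; rewrite ?DL.
Qed.

Lemma card_reduced_bag B : #|reduced_bag B| <= #|B|.
Proof.
apply: leq_trans (subset_leq_card (subD1set _ _)) _; exact: leq_imset_card.
Qed.

Lemma reduced_bag_sub B B' : B \subset B' -> reduced_bag B \subset reduced_bag B'.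
Proof. by move=> sB; apply: setSD; apply: imsetS. Qed.

Lemma cover_reduced_bag B v :
  v \in cover B -> v \notin enclosed -> v \in cover (reduced_bag B).
Proof.
case/bigcupP=> P PB vP vO; have vPO : v \in P :\: enclosed by rewrite inE vO.
apply/bigcupP; exists (P :\: enclosed) => //; rewrite !inE; apply/andP; split.
  by apply/set0Pn; exists v.
exact: imset_f.
Qed.

Lemma reduced_bagU1 P B : reduced_bag (P |: B) =
  (if P \subset enclosed then set0 else [set P :\: enclosed]) :|: reduced_bag B.
Proof.
rewrite /reduced_bag imsetU1 setDUl; congr (_ :|: _).
case: ifP => [|/negbT]; rewrite -setD_eq0.
  by move=> /eqP->; rewrite setDv.
by move=> ne; apply/setDidPl; rewrite disjoints1 inE.
Qed.

Variables (h : nat) (Bpar : {set {set G}}).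
Hypotheses (cardBpar : #|Bpar| <= 2 * h) (aBpar : attached C (cover Bpar)).
Hypothesis dec_leaf : forall D B, D \subset C -> [disjoint D & root_set] ->
  connected_set (V :\: D) -> #|B| <= 2 * h -> attached D (cover B) ->
  dec (4 * h) c B D.

Lemma leaf_nbr D u v : D \in L -> u \in D -> adj u v -> v \in C.
Proof.
move=> DL uD uv; have uC := subsetP (LC DL) u uD; apply: contraT => vC.
have uS : u \in root_set.
  rewrite inE uC; apply/existsP; exists v.
  by rewrite (aC uC vC uv) adj_sym.
by case: (disjointP_in (LS DL) uD uS).
Qed.

Lemma closure_root D : D \in L -> [disjoint closure_of D & root_set].
Proof.
move=> DL; apply/pred0P=> s /=; apply/negP=> /andP[sD sS].
move: (sS); rewrite inE => /andP[sC /existsP[a /andP[aA as_]]].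
have aD : a \notin closure_of D.
  by apply/negP=> /(subsetP (closure_sub (LC DL))); apply: disjointP_in dAC aA.
have sDD : s \in D by apply: closure_edge (LC DL) sD aD _; rewrite adj_sym.
exact: disjointP_in (LS DL) sDD sS.
Qed.

Lemma sub_enclosed D : D \in L -> D \subset enclosed.
Proof.
move=> DL; apply: subset_trans (closure_sup (LC DL)) _.
exact: (bigcup_sup D).
Qed.

(** Each step of the partial decomposition is replayed on trimmed parts, with [Bpar] kept alongside
    because the neighbours of [C] outside [C] lie there. The last two hypotheses make sure that a
    leaf occurs in one branch only and never inside a part. *)
Lemma reduced_dec L' B U :
    @partial_dec K root_set (2 * h) c L' B U ->
    L' \subset L -> U \subset C -> #|B| <= 2 * h ->
    (forall D, D \in L -> D \notin L' -> [disjoint D & U]) ->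
    (forall D, D \in L -> [disjoint D & cover B]) ->
  dec (4 * h) c (reduced_bag B :|: Bpar) (reduced_set L' U).
Proof.
elim=> {L' B U} [B|B D D0 cD dD aD|L1 L2 B U1 U2 dU nU pd1 IH1 pd2 IH2
  |L' B B' P U sB PU cP cB aU pd IH] sL UC leB invU invB.
- have -> : reduced_set set0 set0 = set0.
    apply/setP=> v; rewrite [RHS]inE; apply/reduced_setP=> -[[]|[D []]];
    by rewrite inE.
  exact: dec0.
- have DL : D \in L by rewrite -sub1set.
  case: (boolP (maximal_leaf D)) => mD; last first.
    have -> : reduced_set [set D] D = set0.
      apply/setP=> v; rewrite [RHS]inE; apply/reduced_setP=> -[[vD /negP[]]|[D' []]].
        exact: (subsetP (sub_enclosed DL)).
      by move=> /set1P-> mD'; rewrite mD' in mD.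
    exact: dec0.
  have -> : reduced_set [set D] D = closure_of D.
    apply/setP=> v; apply/reduced_setP/idP=> [[[vD /negP[]]|[D' []]]|vD].
    + exact: (subsetP (sub_enclosed DL)).
    + by move=> /set1P->.
    + by right; exists D; rewrite set11.
  (* Here [Bpar] is dropped: the leaf avoids the root set, so its closure has all outer neighbours
     in the trimmed bag, and the recursion restarts with at most [2 * h] parts. *)
  apply: dec_weaken (subsetUl _ _) _; apply: dec_leaf.
  + exact: closure_sub (LC DL).
  + exact: closure_root.
  + rewrite (closure_compl (LC DL)); exact: component_connected (a0V (LC DL)).
  + exact: leq_trans (card_reduced_bag _) leB.
  + move=> u v uD vD uv; have uDD := closure_edge (LC DL) uD vD uv.
    apply: cover_reduced_bag (maximal_closure_edge mD uD vD uv).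
    apply: (aD u v) => //.
      by apply: contra vD; apply: (subsetP (closure_sup (LC DL))).
    by apply/and3P; split=> //; [apply: (subsetP (LC DL))|apply: leaf_nbr uDD uv].
- have [lf1 _ _] := partial_dec_leaves pd1; have [lf2 _ _] := partial_dec_leaves pd2.
  have [U1C U2C] : U1 \subset C /\ U2 \subset C by apply/andP; rewrite -subUset.
  have [sL1 sL2] : L1 \subset L /\ L2 \subset L by apply/andP; rewrite -subUset.
  have LL D : D \in L1 -> D \in L2 -> False.
    move=> /lf1[sD1 /set0Pn[x xD] _ _] /lf2[sD2 _ _ _].
    exact: disjointP_in dU (subsetP sD1 x xD) (subsetP sD2 x xD).
  have nU' u v : u \in U1 -> v \in U2 -> ~~ @adj G u v.
    move=> uU vU; have := nU u v uU vU; apply: contra => uv.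
    by apply/and3P; split; [apply: (subsetP U1C)|apply: (subsetP U2C)|].
  have -> : reduced_set (L1 :|: L2) (U1 :|: U2) =
      reduced_set L1 U1 :|: reduced_set L2 U2.
    apply/setP=> v; apply/reduced_setP/setUP.
      case=> [[/setUP[]vU vO]|[D [/setUP[]DL mD vD]]].
      + by left; apply/reduced_setP; left.
      + by right; apply/reduced_setP; left.
      + by left; apply/reduced_setP; right; exists D.
      + by right; apply/reduced_setP; right; exists D.
    case=> vR; case/reduced_setP: vR => [[vU vO]|[D [DL mD vD]]].
    + by left; rewrite inE vU.
    + by right; exists D; rewrite inE DL.
    + by left; rewrite inE vU orbT.
    + by right; exists D; rewrite inE DL orbT.
  have clO D v : D \in L -> v \in closure_of D -> v \in enclosed.
    by move=> DL vD; apply/bigcupP; exists D.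
  apply: decU.
  + apply/pred0P=> v /=; apply/negP=> /andP[].
    move=> /reduced_setP[[vU1 vO]|[D [DL mD vD]]] /reduced_setP[[vU2 vO']|[D' [D'L mD' vD']]].
    * exact: disjointP_in dU vU1 vU2.
    * by case/negP: vO; apply: clO vD'; apply: (subsetP sL2).
    * by case/negP: vO'; apply: clO vD; apply: (subsetP sL1).
    * have ne : D != D' by apply/eqP=> E; rewrite -E in D'L; apply: LL DL D'L.
      exact: disjointP_in (maximal_closure_disjoint mD mD' ne) vD vD'.
  + move=> u v /reduced_setP[[uU1 uO]|[D [DL mD uD]]] /reduced_setP[[vU2 vO]|[D' [D'L mD' vD']]].
    * exact: nU'.
    * apply/negP=> uv; have vu : adj v u by rewrite adj_sym.
      have D'LL := subsetP sL2 D' D'L.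
      have uD' : u \notin closure_of D' by apply: contra uO; apply: clO.
      have vDD := closure_edge (LC D'LL) vD' uD' vu.
      have [sD' _ _ _] := lf2 D' D'L.
      by case/negP: (nU' u v uU1 (subsetP sD' v vDD)).
    * apply/negP=> uv; have DLL := subsetP sL1 D DL.
      have vD : v \notin closure_of D by apply: contra vO; apply: clO.
      have uDD := closure_edge (LC DLL) uD vD uv.
      have [sD _ _ _] := lf1 D DL.
      by case/negP: (nU' u v (subsetP sD u uDD) vU2).
    * apply/negP=> uv; have D'LL := subsetP sL2 D' D'L.
      have ne : D != D' by apply/eqP=> E; rewrite -E in D'L; apply: LL DL D'L.
      have vD : v \notin closure_of D.
        apply/negP=> vD; exact: disjointP_in (maximal_closure_disjoint mD mD' ne) vD vD'.
      by case/negP: (maximal_closure_edge mD uD vD uv); apply: clO vD'.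
  + apply: IH1 => // D DL DL1; case: (boolP (D \in L2)) => [/lf2[sD _ _ _]|DL2].
      by apply: disjointWl sD _; rewrite disjoint_sym.
    apply: disjointWr (subsetUl U1 U2) _; apply: invU => //.
    by rewrite inE (negPf DL1).
  + apply: IH2 => // D DL DL2; case: (boolP (D \in L1)) => [/lf1[sD _ _ _]|DL1].
      exact: disjointWl sD _.
    apply: disjointWr (subsetUr U1 U2) _; apply: invU => //.
    by rewrite inE (negPf DL1).
- have [lf _ _] := partial_dec_leaves pd.
  have UPC : U :\: P \subset C := subset_trans (subsetDl _ _) UC.
  have cardPB : #|P |: B'| <= 2 * h.
    by apply: leq_trans cB; rewrite cardsU1 -add1n leq_add2r; case: (_ \notin _).
  have invB' D : D \in L -> [disjoint D & cover (P |: B')].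
    move=> DL; rewrite coverU1; apply/pred0P=> v /=; apply/negP=> /andP[vD].
    case/setUP=> [vP|vB]; last first.
      apply: disjointP_in (invB D DL) vD _; exact: (subsetP (cover_subset sB)).
    case: (boolP (D \in L')) => DL'.
      have [sD _ _ _] := lf D DL'; have /setDP[_ /negP[]//] := subsetP sD v vD.
    exact: disjointP_in (invU D DL DL') vD (subsetP PU v vP).
  have invU' D : D \in L -> D \notin L' -> [disjoint D & U :\: P].
    by move=> DL DL'; apply: disjointWr (subsetDl _ _) _; apply: invU.
  have dc := IH sL UPC cardPB invU' invB'.
  have clO D v : D \in L -> v \in closure_of D -> v \in enclosed.
    by move=> DL vD; apply/bigcupP; exists D.
  have rE : reduced_set L' (U :\: P) = reduced_set L' U :\: (P :\: enclosed).
    apply/setP=> v; rewrite [RHS]inE [v \in P :\: _]inE negb_and negbK.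
    apply/reduced_setP/andP=> [[[/setDP[vU vP] vO]|[D [DL mD vD]]]|].
    + by split; [rewrite vP orbT|apply/reduced_setP; left].
    + split; last by apply/reduced_setP; right; exists D.
      by rewrite (clO D) //; apply: (subsetP sL).
    + case=> H /reduced_setP[[vU vO]|]; last by right.
      by left; rewrite inE vU andbT; move: H; rewrite (negPf vO).
  have sB' : reduced_bag B' :|: Bpar \subset reduced_bag B :|: Bpar.
    by apply: setSU; apply: reduced_bag_sub.
  move: dc; rewrite rE reduced_bagU1; case: ifP => [PO|/negbT PO] dc.
    (* A part swallowed completely leaves nothing to place, so its step disappears. *)
    have PO0 : P :\: enclosed = set0 by apply/eqP; rewrite setD_eq0.
    move: dc; rewrite PO0 setD0 set0U; exact: dec_weaken sB'.
  apply: (@dec_part G _ c _ (reduced_bag B' :|: Bpar) (P :\: enclosed)) => //.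
  + apply/subsetP=> v /setDP[vP vO]; apply/reduced_setP; left; split=> //.
    exact: (subsetP PU).
  + by rewrite setD_eq0.
  + by apply: leq_trans cP; apply: subset_leq_card; apply: subsetDl.
  + apply: leq_ltn_trans (leq_card_setU _ _) _.
    apply: leq_ltn_trans (leq_add (card_reduced_bag _) cardBpar) _.
    by rewrite (_ : 4 * h = 2 * h + 2 * h) ?ltn_add2r // -mulnDl.
  + have outB u v : u \in U -> v \in C -> v \notin U -> v \notin enclosed ->
        @adj G u v -> v \in cover (reduced_bag B').
      move=> uU vC vU vO uv; apply: cover_reduced_bag vO.
      by apply: (aU u v) => //; apply/and3P; split=> //; apply: (subsetP UC).
    move=> u v /reduced_setP[[uU uO]|[D [DL mD uD]]] vU' uv.
      have uC := subsetP UC u uU.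
      case: (boolP (v \in C)) => vC; last first.
        apply: (subsetP (cover_subset (subsetUr _ _))); exact: aBpar uv.
      (* An enclosed [v] would lie in a maximal leaf itself. Inside [U] it would then be in the
         reduced set or violate [invU]; outside [U] it would be in a part of the bag, against
         [invB]. *)
      have vO : v \notin enclosed.
        apply/negP=> /enclosed_maximal[D mD vD]; have [DL _] := andP mD.
        have uD : u \notin closure_of D by apply: contra uO; apply: clO.
        have vDD : v \in D by apply: closure_edge (LC DL) vD uD _; rewrite adj_sym.
        case: (boolP (v \in U)) => vU.
          case: (boolP (D \in L')) => DL'.
            by case/negP: vU'; apply/reduced_setP; right; exists D.
          exact: disjointP_in (invU D DL DL') vDD vU.
        apply: disjointP_in (invB D DL) vDD _.
        apply: (subsetP (cover_subset sB)); apply: (aU u v) => //.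
        exact/and3P.
      apply: (subsetP (cover_subset (subsetUl _ _))); apply: (outB u) => //.
      by apply: contra vU' => vU; apply/reduced_setP; left.
    have DLL := subsetP sL D DL.
    have vD : v \notin closure_of D.
      by apply: contra vU' => vD; apply/reduced_setP; right; exists D.
    have uDD := closure_edge (LC DLL) uD vD uv.
    have vO := maximal_closure_edge mD uD vD uv.
    have [sD _ _ _] := lf D DL; have /setDP[uU _] := subsetP sD u uDD.
    apply: (subsetP (cover_subset (subsetUl _ _))); apply: (outB u) => //.
      exact: leaf_nbr uDD uv.
    by apply: contra vU' => vU; apply/reduced_setP; left.
  + by rewrite setUA.
Qed.

Lemma closure_dec :
  @partial_dec K root_set (2 * h) c L set0 C -> dec (4 * h) c Bpar C.
Proof.
move=> pd.
have := reduced_dec pd (subxx _) (subxx _).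
have -> : reduced_set L C = C.
  apply/setP=> v; apply/reduced_setP/idP=> [[[]//|[D [DL mD vD]]]|vC].
    exact: (subsetP (closure_sub (LC DL))).
  case: (boolP (v \in enclosed)) => vO; last by left.
  by right; have [D mD vD] := enclosed_maximal vO; exists D; case/andP: (mD).
rewrite /reduced_bag imset0 set0D set0U cards0; apply=> // [D ->//|D _].
rewrite /cover big_set0; apply/pred0P=> v /=; by rewrite inE andbF.
Qed.
End Closure.

(** * The recursion on the leftover pieces *)

Section Outer.
Variables (T G : sgraph) (h d k : nat).
Hypotheses (treeT : is_tree T) (cardT : #|T| = k.+1).
Hypotheses (radT : radius T = h) (degT : max_degree T = d) (d0 : 0 < d).
Hypothesis noMinor : ~ minor (add_apex T) G.
Implicit Types (A C : {set G}) (B : {set {set G}}).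

Lemma no_rooted_model A C (M : T -> {set G}) :
    connected_set A -> A != set0 -> [disjoint A & C] ->
  ~ @rooted_model T (induced C) (root_set A C) M.
Proof.
move=> cA A0 dAC [M1 M2 M3 M4]; apply: noMinor.
have MC x : M x \subset C.
  have [s sM sS] := M2 x; have sC : s \in C by move: sS; rewrite inE => /andP[].
  apply: (@connected_set_sub (induced C) (M x) C s (M1 x) sM sC).
  by move=> u v _ _ _ /and3P[].
have dAM x : [disjoint A & M x] by apply: disjointWr (MC x) dAC.
exists (fun o => if o is Some x then M x else A); split.
- by case=> [x|//]; apply/set0Pn; have [s sM _] := M2 x; exists s.
- by case=> [x|//]; apply: induced_connected (M1 x).
- by case=> [x|] [y|] //= ne; [apply: M3|rewrite disjoint_sym].
- have AM x : exists u v, [/\ u \in A, v \in M x & @adj G u v].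
    have [s sM] := M2 x; rewrite inE => /andP[_ /existsP[a /andP[aA as_]]].
    by exists a, s.
  case=> [x|] [y|] //= xy.
  + have [u [v [uM vM /and3P[_ _ uv]]]] := M4 x y xy; by exists u, v.
  + by have [u [v [uA vM uv]]] := AM x; exists v, u; rewrite adj_sym.
Qed.

(** Induction on the size of [C]. A closed piece [D] is decomposed opposite [(A :|: C) :\: D], which
    is connected by the construction of closures. *)
Lemma outer_dec A C B :
    A != set0 -> connected_set A -> connected_set (A :|: C) -> [disjoint A & C] ->
    attached C A -> #|B| <= 2 * h -> attached C (cover B) ->
  dec (4 * h) (d * (2 * k).+1) B C.
Proof.
have [n] := ubnP #|C|; elim: n A C B => // n IH A C B; rewrite ltnS => len.
move=> A0 cA cAC dAC aC leB aB; have /set0Pn[a0 a0A] := A0.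
have [->|[x xC]] := set_0Vmem C; first exact: dec0.
have [p0 [p [l [rT lc lh ch]]]] := tree_rooted treeT.
rewrite radT in lh; have {}ch v : #|[set w | (w != p0) && (p w == v)]| <= d.
  by rewrite -degT.
have [sw|[M rM]] := @sweep_or_model (induced C) (root_set A C) k T p0 p l rT cardT; last first.
  by case: (no_rooted_model cA A0 dAC rM).
have [|Q U ft||L pd] := @partial_dec_exists (induced C) (root_set A C) C
    (d * (2 * k).+1) k d h sw (leqnn _).
- by rewrite muln_gt0 d0.
- have [M rM] := fat_tree_model rT lc ch lh ft.
  exact: no_rooted_model cA A0 dAC rM.
- by move=> u v _ vC /and3P[_]; rewrite (negPf vC).
have [l1 l2 l3] := partial_dec_leaves pd.
have lC D : D \in L -> D \subset C by case/l1.
apply: (closure_dec cA cAC dAC aC a0A (L := L)) => //.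
- by move=> D /l1[_ _ /induced_connected].
- by move=> D /l1[].
- move=> D D' DL D'L ne u v uD vD'; apply: contra (l3 D D' DL D'L ne u v uD vD').
  move=> uv; apply/and3P; split=> //.
    exact: (subsetP (lC D DL)).
  exact: (subsetP (lC D' D'L)).
move=> D B' DC DS cD leB' aD.
have ACD : (A :|: C) :\: D :|: D = A :|: C.
  rewrite setDE setUIl (setUC (~: D)) setUCr setIT; apply/setUidPl.
  exact: subset_trans DC (subsetUr _ _).
apply: (IH ((A :|: C) :\: D)) => //.
- apply: leq_trans len; apply: proper_card; apply/properP; split=> //.
  (* [C] has a vertex adjacent to [A], and [D] avoids all such vertices: hence [D] is strictly
     smaller. *)
  have [u [v [uC vA uv]]] : exists u v, [/\ u \in C, v \in A & adj u v].
    apply: contrapT => no.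
    have xAC : x \in A :|: C by rewrite inE xC orbT.
    have /subsetP/(_ a0) : A :|: C \subset C.
      apply: (connected_set_sub cAC xAC xC) => u v _ /setUP[vA|//] uC uv.
      by case: no; exists u, v.
    rewrite inE a0A => /(_ isT); exact: disjointP_in dAC a0A.
  exists u => //; apply/negP=> uD; apply: (disjointP_in DS uD).
  by rewrite inE uC; apply/existsP; exists v; rewrite vA adj_sym.
- apply/set0Pn; exists a0; rewrite !inE a0A andbT; apply/negP=> /(subsetP DC).
  exact: disjointP_in dAC a0A.
- by rewrite ACD.
- by rewrite -setI_eq0 setIDAC setDIl setDv setI0.
- move=> u v uD vD uv; rewrite inE vD inE.
  have uC := subsetP DC u uD.
  by case: (boolP (v \in C)) => vC; rewrite ?orbT // (aC u v).
Qed.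

(** In each component an arbitrary vertex serves both as the initial connected set and as the first
    part. *)
Lemma graph_dec : 0 < h -> dec (4 * h) (d * (2 * k).+1) set0 [set: G].
Proof.
move=> h0; apply: (@set_components_ind G (dec (4 * h) (d * (2 * k).+1) set0)).
- exact: dec0.
- by move=> U1 U2 _ _ dU nU; apply: decU.
move=> K _ /set0Pn[x xK] cK clK.
have aK : attached K (cover set0).
  by move=> u v uK vK uv; case/negP: vK; apply: clK uv; rewrite ?inE.
apply: (dec_part (B' := set0) (P := [set x])) => //.
- by rewrite sub1set.
- by apply/set0Pn; exists x; rewrite set11.
- by rewrite cards1 muln_gt0 d0.
- by rewrite cards0 muln_gt0.
have xE : [set x] :|: (K :\ x) = K by rewrite setD1K.
apply: (@outer_dec [set x]).
- by apply/set0Pn; exists x; rewrite set11.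
- exact: connected_set1.
- by rewrite xE.
- by rewrite disjoints1 !inE eqxx.
- move=> u v /setD1P[ux uK] vK uv; rewrite inE.
  move: vK; rewrite !inE negb_and negbK => /orP[//|vK].
  by case/negP: vK; apply: clK uv; rewrite ?inE.
- by rewrite cardsU1 cards0 addn0; apply: leq_trans (leq_b1 _) _; rewrite muln_gt0.
- move=> u v /setD1P[ux uK] vK uv; rewrite coverU1 !inE.
  move: vK; rewrite !inE negb_and negbK => /orP[->//|vK].
  by case/negP: vK; apply: clK uv; rewrite ?inE.
Qed.
End Outer.

(** * From decompositions to tree decompositions *)

Section ParentTree.
Variables (N : finType) (r : N) (p : N -> N) (l : N -> nat).
Hypothesis l_parent : forall i, i != r -> l (p i) < l i.

Definition parent_adj : rel N := [rel i j |
  (i != j) && (((i != r) && (p i == j)) || ((j != r) && (p j == i)))].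

Lemma parent_adj_sym : symmetric parent_adj.
Proof. by move=> i j; rewrite /parent_adj /= eq_sym orbC. Qed.

Lemma parent_adj_irr : irreflexive parent_adj.
Proof. by move=> i; rewrite /parent_adj /= eqxx. Qed.

Definition parent_tree : sgraph := SGraph parent_adj_sym parent_adj_irr.

Lemma parent_adjP i : i != r -> @adj parent_tree (p i) i.
Proof.
move=> ir; rewrite -[adj _ _]/(parent_adj (p i) i) /parent_adj /= ir eqxx orbT andbT.
by apply/eqP=> E; have := l_parent ir; rewrite E ltnn.
Qed.

(** Following parents inside [A] leads to [top], since levels drop. *)
Lemma parent_connected (A : {set N}) (top : N) :
    (forall i, i \in A -> i = top \/ i != r /\ p i \in A) ->
  @connected_set parent_tree A.
Proof.
move=> up; apply: (@connected_setI parent_tree) => P x xA xP cl.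
have [topA topP] : top \in A /\ top \in P.
  have [n] := ubnP (l x); elim: n x xA xP => // n IH x xA xP; rewrite ltnS => ln.
  case: (up x xA) => [<-//|[xr pA]]; apply: (IH (p x)) => //.
    by apply: cl xP _ => //; rewrite adj_sym; apply: parent_adjP.
  exact: leq_trans (l_parent xr) ln.
apply/subsetP=> i; have [n] := ubnP (l i); elim: n i => // n IH i; rewrite ltnS.
move=> ln iA; case: (up i iA) => [->//|[ir pA]].
apply: (cl (p i)) => //; last exact: parent_adjP.
by apply: IH => //; apply: leq_trans (l_parent ir) ln.
Qed.

(** On a cycle, both neighbours of a vertex of highest level would have to be its parent. *)
Lemma parent_tree_acyclic : acyclic parent_tree.
Proof.
move=> s s2 us; have [x0 x0s] : exists x, x \in s.
  by case: s s2 {us} => // x s; exists x; rewrite mem_head.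
have [x xs xmax] := @arg_maxnP N x0 (fun x => x \in s) l x0s.
have up y : y \in s -> parent_adj x y -> y = p x.
  move=> ys /andP[_ /orP[/andP[_ /eqP->//]|/andP[yr /eqP E]]].
  have := l_parent yr; rewrite E => lt.
  by have : l y <= l x := xmax y ys; rewrite leqNgt lt.
have [i s' E] := rot_to xs.
have us' : ucycle parent_adj (x :: s') by rewrite -E rot_ucycle.
have size_s' : size (x :: s') = size s by rewrite -E size_rot.
have mem_s' y : y \in x :: s' -> y \in s by rewrite -E mem_rot.
case: s' {E} us' size_s' mem_s' => [|y [|z s']] us' size_s' mem_s';
  rewrite -size_s' // in s2.
case/andP: us'; rewrite (cycle_path x) /= => /and3P[ax xy _].
move=> /and4P[_ ynz _ _].
have yE : y = p x by apply: up xy; apply: mem_s'; rewrite !inE eqxx orbT.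
have lE : last z s' = p x.
  apply: up; last by rewrite parent_adj_sym.
  by apply: mem_s'; rewrite 2!in_cons mem_last !orbT.
by case/negP: ynz; rewrite yE -lE mem_last.
Qed.

Lemma parent_tree_is_tree : is_tree parent_tree.
Proof.
split; [by apply/card_gt0P; exists r | | exact: parent_tree_acyclic].
apply: (@parent_connected _ r) => i _.
by case: (eqVneq i r) => ir; [left | right; rewrite inE].
Qed.
End ParentTree.

Section Realization.
Variables (G : sgraph) (b c : nat).
Implicit Types (B : {set {set G}}) (U P Q W : {set G}).

(** A rooted tree of bags for [U] below the bag [B]. Parts of [B] occupy sets of nodes closed
    towards the root, and any other part has one top node; so each part spans a subtree, and
    realizations can be hung below one another. *)
Record realization B U := Realization {
  node : finType;
  root_node : node;
  parent : node -> node;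
  level : node -> nat;
  bag : node -> {set {set G}};
  level_parent : forall i, i != root_node -> level (parent i) < level i;
  bag_root : bag root_node = B;
  bag_card : forall i, #|bag i| <= b;
  bag_part : forall i P, P \in bag i ->
    P \in B \/ [/\ P \subset U, P != set0 & #|P| <= c];
  bag_cover : forall u, u \in U -> exists i, u \in cover (bag i);
  bag_disjoint : forall i j P Q, P \in bag i -> Q \in bag j ->
    P \notin B -> Q \notin B -> P != Q -> [disjoint P & Q];
  bag_edge : forall u v, u \in U -> v \in U :|: cover B -> adj u v ->
    exists i, (u \in cover (bag i)) && (v \in cover (bag i));
  bag_up_root : forall P i, P \in B -> P \in bag i -> i != root_node ->
    P \in bag (parent i);
  bag_up : forall P, P \notin B -> exists top, forall i, P \in bag i ->
    i = top \/ i != root_node /\ P \in bag (parent i) }.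

Lemma realization0 B : #|B| <= b -> inhabited (realization B set0).
Proof.
move=> leB; apply: inhabits.
apply: (@Realization B set0 unit tt id (fun _ => 0) (fun _ => B)) => //.
- by move=> i P ->; left.
- by move=> u; rewrite inE.
- by move=> i j P Q ->.
- by move=> u v; rewrite inE.
- by move=> P nP; exists tt => i; rewrite (negPf nP).
Qed.

(** The second root becomes a child of the first. With [B2 = B] this handles a union of separate
    sets; with [U1 = set0] and [B2 = P |: B'] it inserts a part. *)
Lemma realization_join B B2 U U1 U2 :
    (forall P, P \in B -> P != set0 /\ [disjoint P & U]) ->
    U1 \subset U -> U2 \subset U -> [disjoint U1 & U2] ->
    (forall P, P \in B2 -> P \notin B -> [/\ P \subset U, P != set0, #|P| <= c,
       [disjoint P & U1] & [disjoint P & U2]]) ->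
    (forall P Q, P \in B2 -> Q \in B2 -> P \notin B -> Q \notin B -> P = Q) ->
    (forall u, u \in U -> [\/ u \in U1, u \in U2 | u \in cover B2]) ->
    (forall u v, u \in U -> v \in U :|: cover B -> adj u v ->
      (exists x y, ((x, y) = (u, v) \/ (x, y) = (v, u)) /\
        (x \in U1 /\ y \in U1 :|: cover B \/ x \in U2 /\ y \in U2 :|: cover B2)) \/
      (u \in cover B2 /\ v \in cover B2)) ->
    inhabited (realization B U1) -> inhabited (realization B2 U2) ->
  inhabited (realization B U).
Proof.
move=> wf sU1 sU2 dU newB2 uniqB2 cov edge [R1] [R2]; apply: inhabits.
pose pp (i : node R1 + node R2) : node R1 + node R2 := match i with
  | inl i => inl (parent i)
  | inr i => if i == root_node R2 then inl (root_node R1) else inr (parent i) end.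
pose ll (i : node R1 + node R2) := match i with
  | inl i => level i | inr i => level i + (level (root_node R1)).+1 end.
pose bb (i : node R1 + node R2) := match i with inl i => bag i | inr i => bag i end.
have wfU P W : P \in B -> P \subset W -> W \subset U -> False.
  move=> PB PW WU; have [/set0Pn[x xP] dj] := wf P PB.
  exact: disjointP_in dj xP (subsetP WU x (subsetP PW x xP)).
have dis0 P W : P != set0 -> P \subset W -> [disjoint P & W] -> False.
  by move=> /set0Pn[x xP] PW dj; apply: disjointP_in dj xP (subsetP PW x xP).
have part1 i P : P \in bag (i : node R1) -> P \notin B ->
    [/\ P \subset U1, P != set0 & #|P| <= c].
  by move=> /bag_part[->|].
apply: (@Realization B U (node R1 + node R2)%type (inl (root_node R1)) pp ll bb).
- case=> i ni /=; first by apply: level_parent; apply: contraNneq ni => ->.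
  case: eqP => [->|/eqP ir] /=; first by rewrite addnS ltnS leq_addl.
  by rewrite ltn_add2r; apply: level_parent.
- exact: bag_root.
- by case=> i; apply: bag_card.
- case=> i P /bag_part[PB|[sP P0 cP]].
  + by left.
  + by right; split=> //; apply: subset_trans sU1.
  + case: (boolP (P \in B)) => PB'; [by left|right].
    by have [? ? ?] := newB2 P PB PB'.
  + by right; split=> //; apply: subset_trans sU2.
- move=> u /cov[uU|uU|uB].
  + by have [i ui] := bag_cover R1 uU; exists (inl i).
  + by have [i ui] := bag_cover R2 uU; exists (inr i).
  + by exists (inr (root_node R2)); rewrite /= bag_root.
- have dis12 i j P Q : P \in bag (i : node R1) -> Q \in bag (j : node R2) ->
      P \notin B -> Q \notin B -> [disjoint P & Q].
    move=> Pi Qj PB QB; have [sP _ _] := part1 i P Pi PB.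
    apply: disjointWl sP _; case: (bag_part Qj) => [QB2|[sQ _ _]].
      by rewrite disjoint_sym; have [] := newB2 Q QB2 QB.
    exact: disjointWr sQ dU.
  case=> i [] j P Q Pi Qj PB QB ne.
  + exact: (bag_disjoint Pi Qj).
  + exact: dis12 Pi Qj PB QB.
  + by rewrite disjoint_sym; apply: dis12 Qj Pi QB PB.
  + case: (boolP (P \in B2)) => PB2; case: (boolP (Q \in B2)) => QB2.
    * by case/eqP: ne; apply: uniqB2.
    * have [|[sQ _ _]] := bag_part Qj; first by rewrite (negPf QB2).
      by apply: disjointWr sQ _; have [] := newB2 P PB2 PB.
    * have [|[sP _ _]] := bag_part Pi; first by rewrite (negPf PB2).
      by apply: disjointWl sP _; rewrite disjoint_sym; have [] := newB2 Q QB2 QB.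
    * exact: (bag_disjoint Pi Qj).
- move=> u v uU vU uv; case: (edge u v uU vU uv) => [[x [y [xyE H]]]|[uB vB]]; last first.
    by exists (inr (root_node R2)); rewrite /= bag_root uB.
  have xy : adj x y by case: xyE => -[-> ->]; rewrite // adj_sym.
  have [i /andP[xi yi]] : exists i, (x \in cover (bb i)) && (y \in cover (bb i)).
    case: H => -[xU yU].
      by have [i H] := bag_edge R1 xU yU xy; exists (inl i).
    by have [i H] := bag_edge R2 xU yU xy; exists (inr i).
  by exists i; case: xyE xi yi => -[-> ->] -> ->.
- move=> P [] i PB Pi ni /=.
    by apply: (bag_up_root PB Pi); apply: contraNneq ni => ->.
  case: eqP => [_|/eqP ir] /=; first by rewrite bag_root.
  apply: (bag_up_root _ Pi ir); case: (bag_part Pi) => [//|[sP _ _]].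
  by case: (wfU P U2 PB sP sU2).
(* A part of [B2] outside [B] has its top at the second root. Any other new part occurs on one side
   only, since it is nonempty and [U1] and [U2] are disjoint. *)
- move=> P PB; case: (boolP (P \in B2)) => PB2.
    exists (inr (root_node R2)); case=> i Pi.
      have [sP P0 _] := part1 i P Pi PB; have [_ _ _ dP _] := newB2 P PB2 PB.
      by case: (dis0 P U1 P0 sP dP).
    case: (eqVneq i (root_node R2)) => [->|ir]; first by left.
    by right; rewrite /= (negPf ir); split=> //; apply: (bag_up_root PB2 Pi ir).
  have [top1 up1] := bag_up R1 PB; have [top2 up2] := bag_up R2 PB2.
  have [[i0 Pi0]|no] := pselect (exists i, P \in bag (i : node R1)).
    exists (inl top1); case=> i Pi.
      by case: (up1 i Pi) => [->|[ir Pp]]; [left|right].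
    have [sP P0 _] := part1 i0 P Pi0 PB.
    have [|[sP2 _ _]] := bag_part Pi; first by rewrite (negPf PB2).
    by case: (dis0 P U1 P0 sP); rewrite disjoint_sym; apply: disjointWr sP2 dU.
  exists (inr top2); case=> i Pi; first by case: no; exists i.
  by case: (up2 i Pi) => [->|[ir Pp]]; [left|right; rewrite /= (negPf ir)].
Qed.

Lemma dec_realization B U :
    dec b c B U -> #|B| <= b ->
    (forall P, P \in B -> P != set0 /\ [disjoint P & U]) ->
  inhabited (realization B U).
Proof.
elim=> {B U} [B|B U1 U2 dU nU _ IH1 _ IH2|B B' P U sB PU P0 cP cB aU _ IH] leB wf.
- exact: realization0.
- apply: (realization_join (B2 := B) (U1 := U1) (U2 := U2)) => //.
  + exact: subsetUl.
  + exact: subsetUr.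
  + by move=> P ->.
  + by move=> P Q ->.
  + by move=> u /setUP[]; [constructor 1|constructor 2].
  + move=> u v uU vU uv; left.
    case/setUP: uU => uU; exists u, v; split; [by left| |by left|].
      left; split=> //; move: vU; rewrite !in_setU => /orP[/orP[->//|vU]|->].
        by case/negP: (nU u v uU vU).
      by rewrite orbT.
    right; split=> //; move: vU; rewrite !in_setU => /orP[/orP[vU|->//]|->].
      by case/negP: (nU v u vU uU); rewrite adj_sym.
    by rewrite orbT.
  + apply: IH1 => // P /wf[P0 dP]; split=> //.
    exact: disjointWr (subsetUl U1 U2) dP.
  + apply: IH2 => // P /wf[P0 dP]; split=> //.
    exact: disjointWr (subsetUr U1 U2) dP.
- apply: (realization_join (B2 := P |: B') (U1 := set0) (U2 := U :\: P)) => //.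
  + exact: sub0set.
  + exact: subsetDl.
  + by rewrite -setI_eq0 set0I.
  + move=> Q /setU1P[->|QB'] QB; last by rewrite (subsetP sB) in QB.
    split=> //; first by rewrite -setI_eq0 setI0.
    by rewrite disjoint_sym -setI_eq0 setIDAC setDIl setDv setI0.
  + by move=> Q Q' /setU1P[->|/(subsetP sB) QB] /setU1P[->|/(subsetP sB) Q'B] // H H';
      [rewrite Q'B in H'|rewrite QB in H|rewrite QB in H].
  + move=> u uU; case: (boolP (u \in P)) => uP.
      by constructor 3; rewrite coverU1 inE uP.
    by constructor 2; rewrite inE uP.
  + move=> u v uU vU uv.
    have vPB : v \in U :|: cover B'.
      rewrite inE; case: (boolP (v \in U)) => // vU'; exact: aU uv.
    have uPB : u \in U :|: cover B' by rewrite inE uU.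
    have split_ x : x \in U :|: cover B' -> x \in U :\: P \/ x \in cover (P |: B').
      rewrite coverU1 => /setUP[xU|xB]; last by right; rewrite inE xB orbT.
      by case: (boolP (x \in P)) => xP; [right; rewrite inE xP|left; rewrite inE xP].
    case: (split_ u uPB) (split_ v vPB) => [uP|uP] [vP|vP].
    * by left; exists u, v; split; [left|right; rewrite in_setU vP].
    * by left; exists u, v; split; [left|right; rewrite in_setU vP orbT].
    * by left; exists v, u; split; [right|right; rewrite in_setU uP orbT].
    * by right.
  + by apply: realization0.
  + apply: IH => [|Q].
      by apply: leq_trans cB; rewrite cardsU1 -add1n leq_add2r; case: (_ \notin _).
    case/setU1P=> [->|QB].
      split=> //; by rewrite disjoint_sym -setI_eq0 setIDAC setDIl setDv setI0.
    have [Q0 dQ] := wf Q (subsetP sB Q QB); split=> //.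
    exact: disjointWr (subsetDl _ _) dQ.
Qed.
End Realization.

(** * The graph of parts and the embedding into its strong product *)

Section PartGraph.
Variables (G : sgraph) (b c : nat) (R : realization b c set0 [set: G]).

Definition used_parts : {set {set G}} := \bigcup_(i : node R) bag i.

Definition part_adj : rel {P | P \in used_parts} := [rel P Q |
  (P != Q) && [exists i : node R, (val P \in bag i) && (val Q \in bag i)]].

Lemma part_adj_sym : symmetric part_adj.
Proof.
move=> P Q; rewrite /part_adj /= eq_sym; congr (_ && _).
by apply: eq_existsb => i; rewrite andbC.
Qed.

Lemma part_adj_irr : irreflexive part_adj.
Proof. by move=> P; rewrite /part_adj /= eqxx. Qed.

Definition part_graph : sgraph := SGraph part_adj_sym part_adj_irr.

Lemma used_partsP P : reflect (exists i : node R, P \in bag i) (P \in used_parts).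
Proof. by apply: (iffP bigcupP) => [[i _ Pi]|[i Pi]]; exists i. Qed.

Lemma treewidth_part_graph : treewidth part_graph <= b - 1.
Proof.
pose bags (i : parent_tree (root_node R) (@parent _ _ _ _ _ R)) : {set part_graph} :=
  [set P : part_graph | val P \in bag (i : node R)].
have tdv (P : part_graph) : exists i, P \in bags i.
  by have /used_partsP[i Pi] := valP P; exists i; rewrite inE.
have tde (P Q : part_graph) : adj P Q -> exists i, (P \in bags i) && (Q \in bags i).
  by case/andP=> _ /existsP[i H]; exists i; rewrite !inE.
have tds (P : part_graph) : connected_set [set i | P \in bags i].
  have [|top up] := @bag_up _ _ _ _ _ R (val P); first by rewrite inE.
  apply: (parent_connected (@level_parent _ _ _ _ _ R) (top := top)) => i.
  by rewrite !inE; apply: up.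
pose D := TreeDecomposition (parent_tree_is_tree (@level_parent _ _ _ _ _ R)) tdv tde tds.
apply: leq_trans (_ : width D <= _).
  rewrite /treewidth; case: ex_minnP => m _; apply.
  by apply/asboolP; exists D.
rewrite /width -subn1 leq_sub2r //; apply/bigmax_leqP=> i _.
apply: leq_trans (bag_card (i : node R)); rewrite -(card_imset _ val_inj).
by apply: subset_leq_card; apply/subsetP=> _ /imsetP[P + ->]; rewrite inE.
Qed.

(** A vertex goes to the part containing it, paired with its position in that part. *)
Lemma contained_part_graph :
  contained G (strong_product part_graph (complete_graph c)).
Proof.
have partP i P : P \in bag (i : node R) -> #|P| <= c.
  by case/bag_part => [|[]//]; rewrite inE.
have part_uniq i j P Q v : P \in bag (i : node R) -> Q \in bag (j : node R) ->
    v \in P -> v \in Q -> P = Q.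
  move=> Pi Qj vP vQ; apply: contraTeq isT => ne.
  have dj : [disjoint P & Q] by apply: (bag_disjoint Pi Qj); rewrite ?inE.
  by case: (disjointP_in dj vP vQ).
have /choice[part partE] : forall v : G, exists P : part_graph, v \in val P.
  move=> v; have [i /bigcupP[P Pi vP]] := bag_cover R (in_setT v).
  have Pu : P \in used_parts by apply/used_partsP; exists i.
  by exists (exist _ P Pu).
have rank v : index v (enum (val (part v))) < c.
  have /used_partsP[i Pi] := valP (part v); apply: leq_trans (partP _ _ Pi).
  by rewrite cardE index_mem mem_enum.
exists (fun v => (part v, Ordinal (rank v))).
have inj : injective (fun v => (part v, Ordinal (rank v))).
  move=> u v [pE iE]; have vu : v \in enum (val (part u)) by rewrite mem_enum pE.
  have uu : u \in enum (val (part u)) by rewrite mem_enum.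
  by rewrite -(nth_index u uu) iE -pE nth_index.
split=> // u v uv; apply/and3P; split.
- by apply: contraTneq uv => /inj->; rewrite adj_irr.
- rewrite /=; case: eqVneq => //= ne; apply/andP; split=> //.
  have [|i /andP[/bigcupP[P Pi uP] /bigcupP[Q Qi vQ]]] :=
      bag_edge R (in_setT u) _ uv; first by rewrite in_setU in_setT.
  have /used_partsP[j uj] := valP (part u); have /used_partsP[j' vj'] := valP (part v).
  apply/existsP; exists i; rewrite (part_uniq _ _ _ _ u uj Pi) //.
  by rewrite (part_uniq _ _ _ _ v vj' Qi) // Pi Qi.
- by rewrite /=; case: eqVneq.
Qed.
End PartGraph.

Lemma tree_edge (T : sgraph) : is_tree T -> 2 <= #|T| -> exists x y : T, adj x y.
Proof.
move=> [_ cT _] /card_gt1P[x [y [_ _ ne]]].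
have /connectP[[|z s] /=] := cT x y (in_setT _) (in_setT _).
  by move=> _ yx; rewrite yx eqxx in ne.
by case/andP=> /and3P[_ _ xz] _ _; exists x, z.
Qed.

Theorem theorem8 (T G : sgraph) (t h d : nat)
  (treeT : is_tree T) (cardT : #|T| = t) (t_ge2 : 2 <= t)
  (radiusT : radius T = h) (degT : max_degree T = d)
  (noMinor : ~ minor (add_apex T) G) :
  exists H : sgraph,
    treewidth H <= 4 * h - 1 /\
    contained G (strong_product H (complete_graph ((2 * t - 1) * d))).
Proof.
have [x [y xy]] : exists x y : T, adj x y by apply: tree_edge; rewrite ?cardT.
have d0 : 0 < d.
  rewrite -degT; apply: leq_trans (leq_bigmax x).
  by apply/card_gt0P; exists y; rewrite inE.
have h0 : 0 < h.
  rewrite lt0n -radiusT; apply/eqP=> r0; have [c cP] := radius_center treeT.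
  have all_c v : v = c.
    have := cP v; rewrite r0 leqn0 => /eqP dv.
    have /walkP[q [+ _ <-]] := dist_walk treeT c v.
    by rewrite dv => /size0nil->.
  by move: xy; rewrite (all_c x) (all_c y) adj_irr.
have tE : t = t.-1.+1 by case: t t_ge2 {cardT}.
rewrite tE in cardT.
have dc := graph_dec treeT cardT radiusT degT d0 noMinor h0.
have [||R] := dec_realization dc; first by rewrite cards0.
  by move=> P; rewrite inE.
exists (part_graph R); split; first exact: treewidth_part_graph.
(* With [k = t.-1], the bag size [2k + 1] of a sweep is [2t - 1]. *)
have -> : (2 * t - 1) * d = d * (2 * t.-1).+1.
  by rewrite mulnC {1}tE mulnS addnC addn2 subn1.
exact: contained_part_graph.
Qed.
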